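(* Let $S_1,\ldots,S_n$ be Polish spaces, $\mu$ a Borel probability measure on $S=\prod_{i=1}^nS_i$, $\mathcal{I}$ a collection of subsets of $\{1,\ldots,n\}$, and $d\in\mathbb{N}$. Assume $\mu$ satisfies $\mathrm{LSI}_{(\partial,\mathcal{I})}(\sigma^2)$ for some $\sigma^2>0$. Let $f\in L^\infty(\mu)$ satisfy \[ \|\mathfrak{h}^{(k)}f\|_2\le\min(1,\sigma^{d-k})\quad\text{for all }k=1,\ldots,d-1,\qquad \|\mathfrak{h}^{(d)}f\|_\infty\le1 . \] Then there exists a constant $c>0$ such that $\mathbb{E}_\mu\exp\big(c|f-\mathbb{E}_\mu f|^{2/d}\big)\le2$; a possible choice is $c=1/(12\sigma^2e)$.
   Context: For $I\subset\{1,\ldots,n\}$ and $x\in S$ write $x_I=(x_i)_{i\in I}$, $\overline{x_I}=(x_i)_{i\notin I}$, $S_I=\prod_{i\in I}S_i$, and $(\overline{x_I},y_I)$ for the point of $S$ with coordinates $y_i$ ($i\in I$) and $x_i$ ($i\notin I$). Let $\overline{\mu_I}$ be the law of $\overline{x_I}$ under $\mu$, and $(m_{\overline{x_I}})$ a disintegration: a Markov kernel of probability measures on $S_I$ with $\int g\,d\mu=\int\int g(\overline{x_I},y_I)\,dm_{\overline{x_I}}(y_I)\,d\overline{\mu_I}(\overline{x_I})$ for $g\in L^1(\mu)$. For $I\in\mathcal{I}$: $\partial_If(x)=\big(\frac12\int(f(x)-f(\overline{x_I},y_I))^2dm_{\overline{x_I}}(y_I)\big)^{1/2}$ and $|\partial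 f|=(\sum_{I\in\mathcal{I}}(\partial_If)^2)^{1/2}$; $\mathfrak{h}_If(x)=\frac1{\sqrt2}\|f(\overline{x_I},y_I)-f(\overline{x_I},z_I)\|_{L^\infty(m_{\overline{x_I}}\otimes m_{\overline{x_I}}(y_I,z_I))}$. Higher order: $\mathfrak{h}_{I_1\ldots I_d}f=\mathfrak{h}_{I_1}(\mathfrak{h}_{I_2\ldots I_d}f)$, $\mathfrak{h}^{(d)}f(x)=(\mathfrak{h}_{I_1\ldots I_d}f(x))_{(I_1,\ldots,I_d)\in\mathcal{I}^d}$, and $|\mathfrak{h}^{(d)}f|$ its Euclidean norm. $\|g\|_p=(\mathbb{E}_\mu|g|^p)^{1/p}$, $\|\mathfrak{h}^{(d)}f\|_p=\||\mathfrak{h}^{(d)}f|\|_p$, with $p=\infty$ the $\mu$-essential supremum. $\mu$ satisfies $\mathrm{LSI}_{(\partial,\mathcal{I})}(\sigma^2)$ if $\mathrm{Ent}_\mu(f^2)\le2\sigma^2\mathbb{E}_\mu|\partial f|^2$ for all $f\in L^\infty(\mu)$, where $\mathrm{Ent}_\mu(g)=\mathbb{E}_\mu g\log g-\mathbb{E}_\mu g\log\mathbb{E}_\mu g$ for $g\ge0$. *)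

(* Defs.v *)
From HB Require Import structures.
From mathcomp Require Import all_boot all_order all_algebra.
From mathcomp Require Import all_classical all_reals all_analysis.
From mathcomp Require Import lebesgue_measure measurable_realfun ess_sup_inf hoelder lebesgue_integral.
Set Implicit Arguments.
Unset Strict Implicit.
Unset Printing Implicit Defensive.
Import Order.TTheory GRing.Theory Num.Theory Num.Def.
Import numFieldNormedType.Exports.
Local Open Scope classical_set_scope.
Local Open Scope ring_scope.

Section Defs.
Context {R : realType} {n : nat}.

(* Polish space: a (pointed) complete metric space which is Hausdorff (so the
   pseudometric is a metric) and separable. *)
Definition polish (T : completePseudoMetricType R) : Prop :=
  hausdorff_space T /\ exists D : set T, countable D /\ dense D.

Definition prodS (S : 'I_n -> completePseudoMetricType R) : Type :=
  prod_topology (fun i => (S i : ptopologicalType)).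
HB.instance Definition _ (S : 'I_n -> completePseudoMetricType R) :=
  Topological.on (prodS S).
HB.instance Definition _ (S : 'I_n -> completePseudoMetricType R) :=
  Pointed.copy (prodS S) (forall i, (S i : ptopologicalType)).
Definition BorelS (S : 'I_n -> completePseudoMetricType R) :=
  g_sigma_algebraType (@open (prodS S)).

Variable S : 'I_n -> completePseudoMetricType R.
Local Notation BS := (BorelS S).

Definition join (I : {set 'I_n}) (x y : BS) : BS :=
  fun i => if i \in I then y i else x i.

Definition Exp (mu : probability BS R) (g : BS -> R) : R :=
  fine (\int[mu]_x (g x)%:E)%E.

(* Ent_mu g = E g log g - E g log E g  (with 0 log 0 = 0, as ln 0 = 0) *)
Definition Ent (mu : probability BS R) (g : BS -> R) : R :=
  Exp mu (fun x => g x * ln (g x)) - Exp mu g * ln (Exp mu g).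

Definition Linfty (mu : probability BS R) (f : BS -> R) : Prop :=
  measurable_fun setT f /\ (Lnorm mu +oo%E (EFin \o f) < +oo)%E.

(* m is a disintegration of mu for the coordinate block I: a Markov kernel
   x |-> m x depending only on xbar_I (its coordinates in I being the relevant
   ones, the point y of S being read only through y_I via join I x y) s.t.
   int g dmu = int int g(xbar_I, y_I) dm_{xbar_I}(y_I) dmu(x). *)
Definition disintegration (mu : probability BS R) (I : {set 'I_n})
    (m : BS -> probability BS R) : Prop :=
  [/\ forall A, measurable A -> measurable_fun [set: BS] ((fun x => m x A) : BS -> \bar R),
      forall x x' : BS, (forall i, i \notin I -> x i = x' i) -> m x = m x'
    & forall g : BS -> R, mu.-integrable setT (EFin \o g) ->
      (\int[mu]_x (g x)%:E = \int[mu]_x \int[m x]_y (g (join I x y))%:E)%E].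

Variable m : {set 'I_n} -> BS -> probability BS R.

Definition partialI (I : {set 'I_n}) (f : BS -> R) (x : BS) : R :=
  Num.sqrt (fine (\int[m I x]_y ((2^-1 * (f x - f (join I x y)) ^+ 2)%:E))%E).

Definition gradnorm (II : {set {set 'I_n}}) (f : BS -> R) (x : BS) : R :=
  Num.sqrt (\sum_(I in II) partialI I f x ^+ 2).

Definition LSI (mu : probability BS R) (II : {set {set 'I_n}}) (sigma2 : R) :=
  forall f : BS -> R, Linfty mu f ->
    Ent mu (fun x => f x ^+ 2) <= 2 * sigma2 * Exp mu (fun x => gradnorm II f x ^+ 2).

Definition hI (I : {set 'I_n}) (f : BS -> R) (x : BS) : R :=
  (Num.sqrt 2)^-1 *
  fine (ess_sup (m I x \x m I x)%E
          (fun yz : BS * BS => (`|f (join I x yz.1) - f (join I x yz.2)|)%:E)).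

Definition hseq (s : seq {set 'I_n}) (f : BS -> R) : BS -> R :=
  foldr hI f s.

Definition hnorm (II : {set {set 'I_n}}) (k : nat) (f : BS -> R) (x : BS) : R :=
  Num.sqrt (\sum_(t : k.-tuple {set 'I_n} | all (fun I => I \in II) t)
              hseq t f x ^+ 2).

End Defs.

(* Main.v *)
(* A log-Sobolev inequality applied to powers of f bounds the entropy of f^(2k)
   by E f^(2k-2) |hf|^2.  Since Ent(F^k) controls
   k (k-1) E F^k (1 - ||F||_(k-1) / ||F||_k) from below for F = f^2, this is a
   recursion ||F||_k <= ||F||_(k-1) + 4 sigma^2 k/(k-1) || |hf|^2 ||_k over the
   integers k, which replaces the usual differential inequality in p; the
   Poincare inequality (linearised log-Sobolev) starts it.  As
   h |h^(l) f| <= |h^(l+1) f|, descending from l = d to l = 0 gives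
   E (f - E f)^(2K) <= (6 K sigma^2)^(d K), and these even moments sum to the
   exponential moment of |f - E f|^(2/d). *)
Require Import Defs.
From HB Require Import structures.
From mathcomp Require Import all_boot all_order all_algebra.
From mathcomp Require Import all_classical all_reals all_analysis.
From mathcomp Require Import lebesgue_measure measurable_realfun ess_sup_inf hoelder lebesgue_integral.
From mathcomp Require Import kernel.
From mathcomp Require Import ring lra.
Import Order.TTheory GRing.Theory Num.Theory Num.Def.
Import numFieldNormedType.Exports.
Local Open Scope classical_set_scope.
Local Open Scope ring_scope.

Set Implicit Arguments.
Unset Strict Implicit.
Unset Printing Implicit Defensive.

(** The descent treats |h^(l) f| as a new function to which the one-block argument applies again.
    What makes that argument work is that h_I f does not depend on the coordinates in [I]: in the
    entropy bound for f^(2k) it has the same value at x and at the resampled point, so the bound is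
    symmetric under resampling and integrates to a single term. At every level the recursion in k
    needs a second moment to start from. For 1 <= l < d it comes from the assumed L^2 bound
    sigma^(d-l); only at l = 0 is it supplied by centring and Poincare. The order K is fixed during
    the descent, so that all moments up to 2K at level l = d - j are governed by one constant (6 K
    sigma^2)^j. The measure-theoretic difficulty is that the gradient compares x with one resampled
    point, whereas h is an essential supremum over two resampled points; they are reconciled only
    almost everywhere. Finally, for V = |f - E f|^(2/d), K^K <= e^K K! turns E V^K <= (6 K
    sigma^2)^K into series terms (6 e sigma^2 c)^K, and c = 1/(12 sigma^2 e) makes them 2^-K. *)

(** * Measurability *)

Lemma polish_second_countable (R : realType) (T : completePseudoMetricType R) :
  polish T -> @second_countable T.
Proof.
move=> [_ [D [cD dD]]].
(* Balls of a pseudometric structure need not be open, hence the interiors. *)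
pose B := \bigcup_n ((fun z : T => (ball z (n.+1%:R^-1 : R))°) @` D).
exists B; [|split].
- by apply: bigcup_countable => // n _; exact: card_le_trans (card_image_le _ _) cD.
- by move=> ? [? _ [? _ <-]]; exact: open_interior.
- move=> x V /nbhs_ballP[] _/posnumP[eps] epsV.
  have [//|N] := @ltr_add_invr R 0%R (eps%:num / 2) _; rewrite add0r => Neps.
  have r0 : 0 < (N.+1%:R^-1 : R) / 2 by rewrite divr_gt0.
  have [|w [xw Dw]] := dD (ball x (N.+1%:R^-1 / 2))° _ (open_interior _).
    by exists x; rewrite /interior; exact: nbhsx_ballx.
  have {}xw := interior_subset xw.
  exists (ball w (N.+1%:R^-1 : R))°; first split.
  + by exists N => //; exists w.
  + rewrite /interior; apply/nbhs_ballP; exists (N.+1%:R^-1 / 2) => //= y xy.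
    rewrite [_^-1]splitr; apply: ball_triangle xy.
    exact: ball_sym.
  + apply: (subset_trans _ epsV) => z /interior_subset wz.
    rewrite /id (splitr eps%:num); apply: (@ball_triangle _ _ w).
      apply: le_ball xw; rewrite (le_trans _ (ltW Neps))// ler_pdivrMr// ler_peMr//.
      by rewrite ler1n.
    exact: le_ball (ltW Neps) _ _.
Qed.

(** The sets containing a box around [x] form a filter. The product topology is a supremum, so
    convergence of this filter to [x] is tested one coordinate at a time, where a box with a single
    nontrivial side suffices. *)
Lemma nbhs_prod_box (R : realType) (n : nat)
    (S : 'I_n -> completePseudoMetricType R) (x : prodS S) (U : set (prodS S)) :
  nbhs x U -> exists V : forall i, set (S i),
    (forall i, nbhs (x i) (V i)) /\ [set y | forall i, V i (y i)] `<=` U.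
Proof.
pose F : set_system (prodS S) := [set W | exists V : forall i, set (S i),
    (forall i, nbhs (x i) (V i)) /\ [set y | forall i, V i (y i)] `<=` W].
have FF : Filter F.
  split.
  - by exists (fun=> setT); split => // i; exact: filterT.
  - move=> P Q [V [nV VP]] [W [nW WQ]]; exists (fun i => V i `&` W i); split.
      by move=> i; exact: filterI.
    by move=> y VWy; split; [apply: VP|apply: WQ] => i; case: (VWy i).
  - by move=> P Q PQ [V [nV VP]]; exists V; split => //; exact: subset_trans PQ.
suff : F --> x by apply.
apply/cvg_sup => i W [W' [[V oV VW'] W'x] W'W].
exists (@dfwith _ (fun i => set (S i)) (fun=> setT) i V); split.
  move=> j; case: dfwithP => [|k _]; last exact: filterT.
  by apply: open_nbhs_nbhs; split => //; move: W'x; rewrite -VW'.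
by move=> y /(_ i); rewrite dfwithin => Vy; apply: W'W; rewrite -VW'.
Qed.

(** All basic boxes inside [U] are taken. Their indices live in a countable type, which keeps the
    union countable. *)
Lemma open_prodS_bigcup_box (R : realType) (n : nat)
    (S : 'I_n -> completePseudoMetricType R) :
  (forall i, polish (S i)) ->
  exists B : forall i, nat -> set (S i), (forall i k, open (B i k)) /\
    forall U : set (prodS S), open U ->
      exists E : set {ffun 'I_n -> nat},
        U = \bigcup_(k in E) [set y | forall i, B i (k i) (y i)].
Proof.
move=> HS.
have HB' : forall i, exists B : nat -> set (S i),
    (forall k, open (B k)) /\
    forall (x : S i) V, nbhs x V -> exists k, B k x /\ B k `<=` V.
  move=> i; have [C cC [oC bC]] := polish_second_countable (HS i).
  (* Enumerating the base by [nat] requires it to be nonempty; a neighbourhood of [point] provides a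
     member. *)
  have /pfcard_geP[C0|[f]] := cC.
    by have [W [CW _] _] := bC point setT filterT; rewrite C0 in CW.
  exists f; split=> [k|x V xV]; first exact/oC/funS.
  have [W [CW Wx] WV] := bC _ _ xV.
  have /(_ W CW)[k _ fkW] := @surj _ _ _ _ f.
  by exists k; rewrite fkW; split.
pose B i := projT1 (cid (HB' i)).
have HB i := projT2 (cid (HB' i)).
exists B; split => [i|U oU]; first by have [] := HB i.
exists [set k : {ffun 'I_n -> nat} | [set y | forall i, B i (k i) (y i)] `<=` U].
apply/seteqP; split => [x Ux|x [k /= kU]]; last exact: kU.
have /nbhs_prod_box[V [nV VU]] : nbhs x U by exact: open_nbhs_nbhs.
have /choice[k Hk] : forall i, exists k, B i k (x i) /\ B i k `<=` V i.
  by move=> i; have [_] := HB i; apply; exact: nV.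
exists (finfun k) => /= [y By|i]; last by rewrite ffunE; case: (Hk i).
by apply: VU => i; have [_] := Hk i; apply; have := By i; rewrite ffunE.
Qed.

(* The product sigma-algebra on pairs could be smaller than the Borel one; separability
   rules this out, since open sets are then countable unions of boxes. *)
Lemma measurable_join (R : realType) (n : nat)
    (S : 'I_n -> completePseudoMetricType R) (I : {set 'I_n}) :
  (forall i, polish (S i)) ->
  measurable_fun setT (fun p : BorelS S * BorelS S => join I p.1 p.2).
Proof.
move=> HS; have [B [oB HB]] := open_prodS_bigcup_box HS.
have mp i k : measurable ([set y | B i k (y i)] : set (BorelS S)).
  apply: sub_sigma_algebra; apply: (@open_comp _ _ (fun y : prodS S => y i)) (oB i k).
  by move=> y _; exact: (@proj_continuous _ S i y).
apply: (@measurability _ _ _ (BorelS S) setT _ (@open (prodS S)) erefl).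
move=> _ [U oU <-]; rewrite setTI; have [E ->] := HB _ oU.
rewrite preimage_bigcup bigcup_mkcond; apply: countable_bigcupT_measurable => [|k].
  exact: countableP.
case: ifPn => // _.
rewrite [X in measurable X](_ : _ = \bigcap_(i in [set: 'I_n])
   ((if i \in I then snd else fst) @^-1` [set y : BorelS S | B i (k i) (y i)])).
  apply: fin_bigcap_measurable => [|i _]; first exact: finite_finset.
  rewrite -[X in measurable X]setTI; case: ifPn => _.
    exact: measurable_snd.
  exact: measurable_fst.
apply/seteqP; split => p /= pB i; first by move=> _; have := pB i; rewrite /join; case: ifPn.
by have := pB i Logic.I; rewrite /join; case: ifPn.
Qed.

(** A disintegration is given as a bare family of measures; packing it as a probability kernel gives
    access to the measurability of kernel integrals. *)
Lemma measurable_fun_integral_prob (R : realType) d (X : measurableType d)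
    d' (Y : measurableType d') (k : X -> probability Y R) (phi : X * Y -> \bar R) :
  (forall A, measurable A -> measurable_fun setT ((fun x => k x A) : X -> \bar R)) ->
  (forall p, 0 <= phi p)%E -> measurable_fun setT phi ->
  measurable_fun setT (fun x => \int[k x]_y phi (x, y))%E.
Proof.
move=> mk phi0 mphi.
pose k0 : X -> {measure set Y -> \bar R} := k.
pose k1 : R.-ker X ~> Y := HB.pack k0 (isKernel.Build _ _ X Y R k0 mk).
have pk1 x : k1 x setT = 1%E by exact: probability_setT.
pose k2 : R.-pker X ~> Y := HB.pack k0 (isKernel.Build _ _ X Y R k0 mk)
  (Kernel_isProbability.Build _ _ X Y R k1 pk1).
exact: (measurable_fun_integral_finite_kernel _ k2).
Qed.

Lemma measurable_fun_prob_section (R : realType) d (X : measurableType d)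
    d' (Y : measurableType d') (k : X -> probability Y R) (A : set (X * Y)) :
  (forall A, measurable A -> measurable_fun setT ((fun x => k x A) : X -> \bar R)) ->
  measurable A ->
  measurable_fun setT (fun x => k x [set y | A (x, y)]).
Proof.
move=> mk mA.
rewrite (_ : (fun x => _) = (fun x => \int[k x]_y (\1_A (x, y))%:E)%E).
  apply: (measurable_fun_integral_prob (phi := fun p => (\1_A p)%:E)) => //.
  by apply/measurable_EFinP; exact: measurable_indic.
apply/funext => x; rewrite -(setIT [set y | _]) -integral_indic//.
have := measurable_xsection x mA; rewrite /xsection.
by rewrite (_ : [set y | _] = [set y | A (x, y)])//; apply/seteqP; split => y /=; rewrite inE.
Qed.

Lemma measurable_fun_prob2_section (R : realType) d (X : measurableType d)
    d' (Y : measurableType d') (k : X -> probability Y R) (A : set (X * (Y * Y))) :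
  (forall A, measurable A -> measurable_fun setT ((fun x => k x A) : X -> \bar R)) ->
  measurable A ->
  measurable_fun setT (fun x => (k x \x k x)%E [set y | A (x, y)]).
Proof.
move=> mk mA.
rewrite (_ : (fun x => _) =
   (fun x => \int[k x]_y (k x) [set z | A (x, (y, z))])%E); last first.
  apply/funext => x; rewrite /product_measure1; apply: eq_integral => y _.
  by congr (k x _); apply/seteqP; split => z /=; rewrite /xsection/= inE.
apply: (measurable_fun_integral_prob (phi := fun p => (k p.1) [set z | A (p.1, (p.2, z))])) => //.
have mA' : measurable [set q : (X * Y) * Y | A (q.1.1, (q.1.2, q.2))].
  rewrite -[X in measurable X]setTI.
  suff : measurable_fun setT (fun q : (X * Y) * Y => (q.1.1, (q.1.2, q.2))).
    by move=> /(_ measurableT A mA).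
  apply/measurable_fun_pairP; split; first exact: measurableT_comp measurable_fst measurable_fst.
  apply/measurable_fun_pairP; split; last exact: measurable_snd.
  exact: measurableT_comp measurable_snd measurable_fst.
(* The inner mass is a section under the kernel with parameter (x, y) that ignores y. *)
apply: (measurable_fun_prob_section (k := fun p : X * Y => k p.1) _ mA').
move=> B mB; exact: measurableT_comp (mk B mB) measurable_fst.
Qed.

(** The essential supremum exceeds [a] exactly when the set where [phi] exceeds [a] has nonzero
    mass, and that mass is measurable in x. *)
Lemma measurable_fun_ess_sup (R : realType) d (X : measurableType d)
    d' (Y : measurableType d') (k : X -> probability Y R)
    (phi : X * (Y * Y) -> \bar R) :
  (forall A, measurable A -> measurable_fun setT ((fun x => k x A) : X -> \bar R)) ->
  measurable_fun setT phi ->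
  measurable_fun setT (fun x => ess_sup (k x \x k x)%E (fun y => phi (x, y))).
Proof.
move=> mk mphi.
apply: (measurability _ (ErealGenOInfty.measurableE R)) => // _ [_ [a ->] <-].
rewrite setTI.
pose A := [set p | (a%:E < phi p)%E].
have mA : measurable A.
  rewrite /A -[X in measurable X]setTI; exact: emeasurable_fun_o_infty.
rewrite [X in measurable X](_ : _ =
   ~` ((fun x => (k x \x k x)%E [set y | A (x, y)]) @^-1` [set 0%E])).
  apply: measurableC; rewrite -[X in measurable X]setTI.
  by apply: (measurable_fun_prob2_section mk mA) => //.
have AE x : (phi \o pair x) @^-1` `]a%:E, +oo[ = [set y | A (x, y)].
  by apply/seteqP; split => y /=; rewrite in_itv/= andbT.
have mphix x : measurable_fun setT (phi \o pair x).
  exact: measurableT_comp mphi (measurable_pair1 x).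
apply/seteqP; split => x /=; rewrite in_itv/= andbT.
  apply: contraPnot; rewrite -AE => /ae_le_measureP h; apply/negP.
  by rewrite -leNgt; apply/ess_supP; exact: h.
apply: contra_notT; rewrite -leNgt -AE => /ess_supP h.
by apply/ae_le_measureP.
Qed.

(** * Essentially bounded functions *)

Section essentially_bounded.
Context d (T : measurableType d) (R : realType) (mu : probability T R).
Implicit Types f g : T -> R.

(** A working form of membership in L^oo: with an explicit real bound, closure under ring operations
    is immediate, and every such function has a finite integral. *)
Definition ebounded f := measurable_fun setT f /\
  exists M : R, \forall x \ae mu, `|f x| <= M.

Lemma ebounded_cst (r : R) : ebounded (cst r).
Proof. by split => //; exists `|r|; exact: aeW. Qed.

Lemma ebounded_le f g : measurable_fun setT f -> ebounded g ->
  (\forall x \ae mu, `|f x| <= `|g x|) -> ebounded f.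
Proof.
move=> mf [mg [M gM]] fg; split => //; exists M.
by apply: filterS2 fg gM => x; exact: le_trans.
Qed.

Lemma eboundedD f g : ebounded f -> ebounded g -> ebounded (fun x => f x + g x).
Proof.
move=> [mf [M fM]] [mg [N gN]]; split; first exact: measurable_funD.
exists (M + N); apply: filterS2 fM gN => x fM gN.
by rewrite (le_trans (ler_normD _ _))// lerD.
Qed.

Lemma eboundedM f g : ebounded f -> ebounded g -> ebounded (fun x => f x * g x).
Proof.
move=> [mf [M fM]] [mg [N gN]]; split; first exact: measurable_funM.
exists (M * N); apply: filterS2 fM gN => x fM gN.
by rewrite normrM ler_pM.
Qed.

Lemma eboundedZ r f : ebounded f -> ebounded (fun x => r * f x).
Proof. by move=> bf; exact: eboundedM (ebounded_cst r) bf. Qed.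

Lemma eboundedB f g : ebounded f -> ebounded g -> ebounded (fun x => f x - g x).
Proof.
move=> bf /(eboundedZ (-1)) bg.
by have := eboundedD bf bg; under eq_fun do rewrite mulN1r.
Qed.

Lemma eboundedX f k : ebounded f -> ebounded (fun x => f x ^+ k).
Proof.
move=> bf; elim: k => [|k ih]; first by under eq_fun do rewrite expr0; exact: ebounded_cst.
by under eq_fun do rewrite exprS; exact: eboundedM.
Qed.

Lemma ebounded_sum (I : Type) (s : seq I) (P : pred I) (F : I -> T -> R) :
  (forall i, P i -> ebounded (F i)) ->
  ebounded (fun x => \sum_(i <- s | P i) F i x).
Proof.
move=> bF; elim: s => [|i s ih].
  by under eq_fun do rewrite big_nil; exact: ebounded_cst.
under eq_fun do rewrite big_cons.
by case: (P i) (bF i) => // /(_ isT) bFi; exact: eboundedD.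
Qed.

Lemma ebounded_integrable f : ebounded f -> mu.-integrable setT (EFin \o f).
Proof.
move=> [mf [M fM]]; apply/integrableP; split; first exact/measurable_EFinP.
apply: (@le_lt_trans _ _ (\int[mu]_x (cst (`|M|%:E) x))%E).
  apply: ae_ge0_le_integral => //.
  - by apply: measurableT_comp => //; exact/measurable_EFinP.
  - by move=> x _; rewrite lee_fin.
  by apply: filterS fM => x fM _; rewrite /= lee_fin (le_trans fM)// ler_norm.
by rewrite integral_cst// [X in (_ * X)%E]probability_setT mule1 ltry.
Qed.

Lemma le_Rintegral_ae f g : mu.-integrable setT (EFin \o f) ->
  mu.-integrable setT (EFin \o g) ->
  (\forall x \ae mu, f x <= g x) -> (\int[mu]_x f x <= \int[mu]_x g x).
Proof.
move=> intf intg fg.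
have mf : measurable_fun setT f by apply/measurable_EFinP; exact: measurable_int intf.
have mg : measurable_fun setT g by apply/measurable_EFinP; exact: measurable_int intg.
rewrite -subr_ge0 -RintegralB//.
rewrite [leRHS](_ : _ = \int[mu]_x `|g x - f x|); first exact: Rintegral_ge0.
congr fine; apply: ae_eq_integral => //.
- by apply/measurable_EFinP; exact: measurable_funB.
- by apply/measurable_EFinP; apply: measurableT_comp => //; exact: measurable_funB.
- by apply: filterS fg => x fg _; rewrite ger0_norm// subr_ge0.
Qed.

Lemma ebounded_fineK f : ebounded f ->
  ((\int[mu]_x f x)%:E = \int[mu]_x (f x)%:E)%E.
Proof. by move=> /ebounded_integrable ?; rewrite fineK//; exact: integrable_fin_num. Qed.

Lemma Linfty_ebounded f : measurable_fun setT f ->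
  (Lnorm mu +oo%E (EFin \o f) < +oo)%E <-> exists M : R, \forall x \ae mu, `|f x| <= M.
Proof.
move=> mf; have mu1 : (0 < mu setT)%E by rewrite probability_setT.
rewrite unlock mu1.
split.
  case Ms : (ess_sup _ _) => [M| |]// _.
    exists M; have /ess_supP : (ess_sup mu (abse \o (EFin \o f)) <= M%:E)%E by rewrite Ms.
    by apply: filterS => x /=; rewrite lee_fin.
  exists 0; have /ess_supP : (ess_sup mu (abse \o (EFin \o f)) <= -oo)%E by rewrite Ms.
  by apply: filterS => x /=; rewrite leeNy_eq.
move=> [M fM]; apply: (@le_lt_trans _ _ M%:E); last exact: ltry.
by apply/ess_supP; apply: filterS fM => x /=; rewrite lee_fin.
Qed.

End essentially_bounded.

(** * Null sets of a product of a probability with itself *)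

Section almost_everywhere_product.
Context d (T : measurableType d) (R : realType) (nu : probability T R).

Lemma ae_fubini (P : T * T -> Prop) :
  (\forall p \ae (nu \x nu)%E, P p) ->
  \forall y \ae nu, \forall z \ae nu, P (y, z).
Proof.
move=> [N [mN N0 PN]].
have : ae_eq nu setT (fun y => nu (xsection N y)) (cst 0%E).
  apply/ae_eq_integral_abs => //; first exact: measurable_fun_xsection.
  rewrite -[RHS]N0 /product_measure1; apply: eq_integral => y _.
  by rewrite gee0_abs.
apply: filterS => y /(_ Logic.I) Ny0; exists (xsection N y); split => //.
  exact: measurable_xsection.
by move=> z /= Pyz; apply/xsectionP; exact: PN.
Qed.

Lemma ae_fst (P : T -> Prop) :
  (\forall y \ae nu, P y) -> \forall p \ae (nu \x nu)%E, P p.1.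
Proof.
move=> [N [mN N0 PN]]; exists (N `*` setT); split => [||p Np].
- exact: measurableX.
- by rewrite product_measure1E// [X in (X * _)%E]N0 mul0e.
- by split => //; exact: PN.
Qed.

Lemma ae_snd (P : T -> Prop) :
  (\forall y \ae nu, P y) -> \forall p \ae (nu \x nu)%E, P p.2.
Proof.
move=> [N [mN N0 PN]]; exists (setT `*` N); split => [||p Np].
- exact: measurableX.
- by rewrite product_measure1E// [X in (_ * X)%E]N0 mule0.
- by split => //; exact: PN.
Qed.

Lemma product_probability_setT : (nu \x nu)%E setT = 1%E.
Proof.
by rewrite -setXTT product_measure1E// [X in (X * _)%E]probability_setT
  [X in (_ * X)%E]probability_setT mule1.
Qed.

Lemma ae_forall_fin (I : finType) (P : pred I) (A : I -> T -> Prop) :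
  (forall i, P i -> \forall x \ae nu, A i x) -> \forall x \ae nu, forall i, P i -> A i x.
Proof.
move=> h.
have : \forall x \ae nu, forall i, i \in enum I -> P i -> A i x.
  elim: (enum I) => [|i s ih]; first exact: aeW.
  case: (boolP (P i)) => Pi.
    apply: filterS2 (h i Pi) ih => x Ai ih j; rewrite inE => /predU1P[->//|]; exact: ih.
  apply: filterS ih => x ih j; rewrite inE => /predU1P[->|]; last exact: ih.
  by rewrite (negbTE Pi).
by apply: filterS => x hx i; apply: hx; rewrite mem_enum.
Qed.

End almost_everywhere_product.

(** * Resampling one block *)

(* J x y stands for the point (xbar_I, y_I) and K x for the conditional law of the block I. *)
Section resampling.
Context d (T : measurableType d) (R : realType) (mu : probability T R).
Variables (K : T -> probability T R) (J : T -> T -> T).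
Hypothesis mK : forall A, measurable A -> measurable_fun setT ((fun x => K x A) : T -> \bar R).
Hypothesis mJ : measurable_fun setT (fun p : T * T => J p.1 p.2).
Hypothesis JJ : forall x y z, J (J x y) z = J x z.
Hypothesis KJ : forall x y, K (J x y) = K x.
Hypothesis disint : forall g : T -> R, mu.-integrable setT (EFin \o g) ->
  (\int[mu]_x (g x)%:E = \int[mu]_x \int[K x]_y (g (J x y))%:E)%E.

Let mJx x : measurable_fun setT (J x).
Proof. exact: (measurable_fun_pair2 (f := fun p : T * T => J p.1 p.2)). Qed.

Lemma measurable_resample_section A : measurable A ->
  measurable_fun setT (fun x => K x [set y | A (J x y)]).
Proof.
move=> mA; apply: (measurable_fun_prob_section (A := [set p | A (J p.1 p.2)])) => //.
by rewrite -[X in measurable X]setTI; exact: mJ.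
Qed.

(** The disintegration formula at indicators: [mu] is invariant under resampling the block. Null
    sets therefore transfer both from x to [J x y] and back. *)
Lemma resample_prob A : measurable A -> (mu A = \int[mu]_x K x [set y | A (J x y)])%E.
Proof.
move=> mA; rewrite -[LHS]mul1e -(integral_cst mu) //.
have iA : mu.-integrable setT (EFin \o \1_A) by exact: integrable_indic.
transitivity (\int[mu]_x (\1_A x)%:E)%E.
  by rewrite integral_indic// setIT integral_cst// mul1e.
rewrite disint//; apply: eq_integral => x _.
have mA' : measurable [set y | A (J x y)].
  by rewrite -[X in measurable X]setTI; exact: mJx.
rewrite -(setIT [set y | A (J x y)]) -integral_indic//.
Qed.

Lemma ae_resample (P : T -> Prop) : (\forall x \ae mu, P x) ->
  \forall x \ae mu, \forall y \ae K x, P (J x y).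
Proof.
move=> [N [mN N0 PN]].
have : ae_eq mu setT (fun x => K x [set y | N (J x y)]) (cst 0%E).
  apply/ae_eq_integral_abs => //; first exact: measurable_resample_section.
  rewrite -[RHS]N0 resample_prob//; apply: eq_integral => x _.
  by rewrite gee0_abs.
apply: filterS => x /(_ Logic.I) NJ0; exists [set y | N (J x y)]; split => //.
  by rewrite -[X in measurable X]setTI; exact: mJx.
by move=> y /= Py; apply: PN.
Qed.

Lemma ae_unresample (A : set T) : measurable A ->
  (\forall x \ae mu, \forall y \ae K x, A (J x y)) -> \forall x \ae mu, A x.
Proof.
move=> mA AJ; exists (~` A); split => //; first exact: measurableC.
rewrite resample_prob; last exact: measurableC.
rewrite -[RHS](integral0 mu setT); apply: ae_eq_integral => //.
  by apply: measurable_resample_section; exact: measurableC.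
apply: filterS AJ => x [N [mN N0 AN]] _.
apply: (subset_measure0 _ mN) => //.
by rewrite -[X in measurable X]setTI; apply: mJx => //; exact: measurableC.
Qed.

Definition ess_oscillation (f : T -> R) (x : T) : \bar R :=
  ess_sup (K x \x K x)%E (fun yz : T * T => (`|f (J x yz.1) - f (J x yz.2)|)%:E).

(* Convertible to [hI m I f] for K := m I and J := join I. *)
Definition oscillation (f : T -> R) (x : T) : R :=
  (Num.sqrt 2)^-1 * fine (ess_oscillation f x).

(** The conditional law and both resampled points forget the block of x. This later makes h_I f a
    common factor of the two terms of the symmetric bound. *)
Lemma oscillation_resample f x y : oscillation f (J x y) = oscillation f x.
Proof.
by rewrite /oscillation /ess_oscillation KJ; congr (_ * fine (ess_sup _ _)); apply/funext => z; rewrite !JJ.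
Qed.

Lemma measurable_oscillation f : measurable_fun setT f ->
  measurable_fun setT (oscillation f).
Proof.
move=> mf; apply: measurable_funM => //.
apply: (measurableT_comp (f := fine)); first exact: fine_measurable.
apply: (measurable_fun_ess_sup (k := K)
  (phi := fun p : T * (T * T) => (`|f (J p.1 p.2.1) - f (J p.1 p.2.2)|)%:E)) => //.
apply/measurable_EFinP; apply: measurableT_comp => //.
have mp (h : T * (T * T) -> T) : measurable_fun setT h ->
    measurable_fun setT (fun p => f (J p.1 (h p))).
  move=> mh; apply: (measurableT_comp mf).
  apply: (measurableT_comp (f := fun p : T * T => J p.1 p.2)
    (g := fun p : T * (T * T) => (p.1, h p))) => //.
  exact: measurable_fun_pair.
apply: measurable_funB; apply: mp.
  exact: measurableT_comp measurable_fst measurable_snd.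
exact: measurableT_comp measurable_snd measurable_snd.
Qed.

Lemma ess_oscillation_ge0 f x : (0 <= ess_oscillation f x)%E.
Proof.
apply: ess_sup_gee; first by rewrite [X in (_ < X)%E]product_probability_setT.
by apply: aeW => p; rewrite lee_fin.
Qed.

Lemma oscillation_ge0 f x : 0 <= oscillation f x.
Proof.
by rewrite mulr_ge0// ?invr_ge0 ?sqrtr_ge0// fine_ge0// ess_oscillation_ge0.
Qed.

Lemma ess_oscillation_le f x (M : R) : (\forall y \ae K x, `|f (J x y)| <= M) ->
  (ess_oscillation f x <= (M + M)%:E)%E.
Proof.
move=> fM; apply/ess_supP; apply: filterS2 (ae_fst fM) (ae_snd fM) => p p1 p2.
by rewrite lee_fin (le_trans (ler_normB _ _))// lerD.
Qed.

(** [fine] sends an infinite supremum to 0, so [oscillation] carries the true value only where a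
    bound along the block is available. *)
Lemma ess_oscillationE f x (M : R) : (\forall y \ae K x, `|f (J x y)| <= M) ->
  ess_oscillation f x = (Num.sqrt 2 * oscillation f x)%:E.
Proof.
move=> /ess_oscillation_le fM.
rewrite /oscillation mulVKf ?gt_eqF ?sqrtr_gt0// fineK// ge0_fin_numE.
  exact: le_lt_trans fM (ltry _).
exact: ess_oscillation_ge0.
Qed.

Lemma ae_oscillation f : ebounded mu f ->
  \forall x \ae mu, \forall y \ae K x, \forall z \ae K x,
    `|f (J x y) - f (J x z)| <= Num.sqrt 2 * oscillation f x.
Proof.
move=> [mf [M /ae_resample fM]]; apply: filterS fM => x fM.
have := @ess_sup_ge _ _ _ (K x \x K x)%E
  (fun yz : T * T => (`|f (J x yz.1) - f (J x yz.2)|)%:E).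
rewrite -/(ess_oscillation f x) (ess_oscillationE fM) => h.
apply: (ae_fubini (P := fun p => `|f (J x p.1) - f (J x p.2)| <= Num.sqrt 2 * oscillation f x)).
by apply: filterS h => p; rewrite lee_fin.
Qed.

Lemma ebounded_oscillation f : ebounded mu f -> ebounded mu (oscillation f).
Proof.
move=> [mf [M /ae_resample fM]]; split; first exact: measurable_oscillation.
exists ((Num.sqrt 2)^-1 * (M + M)); apply: filterS fM => x fM.
rewrite ger0_norm ?oscillation_ge0// ler_wpM2l ?invr_ge0 ?sqrtr_ge0//.
rewrite -lee_fin fineK ?ess_oscillation_le// (ess_oscillationE fM)//.
Qed.

(* The essential supremum only compares two resampled blocks; the disintegration lets x itself
   play the role of one of them. *)
Lemma ae_oscillation_resample f : ebounded mu f ->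
  \forall x \ae mu, \forall y \ae K x,
    (f x - f (J x y)) ^+ 2 <= 2 * oscillation f x ^+ 2.
Proof.
move=> bf; have mf := bf.1.
have mo := measurable_oscillation mf.
pose N := [set p : T * T | 2 * oscillation f p.1 ^+ 2 < (f p.1 - f (J p.1 p.2)) ^+ 2].
have mN : measurable N.
  rewrite -[N]setTI; apply: measurable_fun_ltr => //.
    apply: measurable_funM => //; apply: measurable_funX.
    exact: measurableT_comp mo measurable_fst.
  apply: measurable_funX; apply: measurable_funB.
    exact: measurableT_comp mf measurable_fst.
  exact: measurableT_comp mf mJ.
(* [ae_unresample] needs a measurable set, so the inner almost-everywhere statement is encoded as a
   vanishing kernel mass. *)
pose A := [set x | K x [set y | N (x, y)] = 0%E].
have mA : measurable A.
  have := measurable_fun_prob_section mK mN => /(_ measurableT [set 0%E]).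
  by rewrite setTI; apply.
have mNx x : measurable [set y | N (x, y)].
  rewrite -[X in measurable X]setTI; exact: (pair1_measurable x).
suff : \forall x \ae mu, A x.
  apply: filterS => x Ax; exists [set y | N (x, y)]; split => //.
  by move=> y /= /negP; rewrite -ltNge.
apply: (ae_unresample mA); apply: filterS (ae_oscillation bf) => x.
apply: filterS => y [W [mW W0 oW]]; rewrite /A/= KJ.
apply: (subset_measure0 _ mW) => //.
apply: subset_trans oW => z /=; rewrite /N /= JJ oscillation_resample => ltN.
have s0 := mulr_ge0 (sqrtr_ge0 2) (oscillation_ge0 f x).
apply/negP; rewrite -ltNge -ltr_sqr ?nnegrE//.
by rewrite exprMn sqr_sqrtr// real_normK// num_real.
Qed.

(** The factor 1/2 in the block gradient splits over Q(x) and Q(J x y), and the two halves have the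
    same integral because resampling preserves [mu]. *)
Lemma integral_resample_sqr_le (u Q : T -> R) : ebounded mu u -> ebounded mu Q ->
  (forall x, 0 <= Q x) ->
  (\forall x \ae mu, \forall y \ae K x, (u x - u (J x y)) ^+ 2 <= Q x + Q (J x y)) ->
  (\int[mu]_x (Num.sqrt (fine (\int[K x]_y (2^-1 * (u x - u (J x y)) ^+ 2)%:E)) ^+ 2)%:E
   <= \int[mu]_x (Q x)%:E)%E.
Proof.
move=> bu bQ Q0 uQ; have mu_ := bu.1; have mQ := bQ.1.
pose E x := (\int[K x]_y (2^-1 * (u x - u (J x y)) ^+ 2)%:E)%E.
pose F x := (\int[K x]_y (2^-1 * Q (J x y))%:E)%E.
have E0 x : (0 <= E x)%E.
  by apply: integral_ge0 => y _; rewrite lee_fin mulr_ge0// sqr_ge0.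
have F0 x : (0 <= F x)%E.
  by apply: integral_ge0 => y _; rewrite lee_fin mulr_ge0.
have mE : measurable_fun setT E.
  apply: (measurable_fun_integral_prob
    (phi := fun p => (2^-1 * (u p.1 - u (J p.1 p.2)) ^+ 2)%:E)) => //.
    by move=> p; rewrite lee_fin mulr_ge0// sqr_ge0.
  apply/measurable_EFinP; apply: measurable_funM => //; apply: measurable_funX.
  apply: measurable_funB; first exact: measurableT_comp mu_ measurable_fst.
  exact: measurableT_comp mu_ mJ.
have mF : measurable_fun setT F.
  apply: (measurable_fun_integral_prob
    (phi := fun p => (2^-1 * Q (J p.1 p.2))%:E)) => //.
    by move=> p; rewrite lee_fin mulr_ge0.
  apply/measurable_EFinP; apply: measurable_funM => //.
  exact: measurableT_comp mQ mJ.
have EF : \forall x \ae mu, (E x <= (2^-1 * Q x)%:E + F x)%E.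
  apply: filterS uQ => x uQ.
  rewrite -[X in (X + _)%E]mule1 -(probability_setT (K x)) -integral_cst//.
  rewrite -ge0_integralD//; last 3 first.
  - by move=> y _; rewrite lee_fin mulr_ge0.
  - by move=> y _; rewrite lee_fin mulr_ge0.
  - apply/measurable_EFinP; apply: measurable_funM => //.
    exact: measurableT_comp mQ (mJx x).
  apply: ae_ge0_le_integral => //.
  - by move=> y _; rewrite lee_fin mulr_ge0// sqr_ge0.
  - apply/measurable_EFinP; apply: measurable_funM => //; apply: measurable_funX.
    by apply: measurable_funB => //; exact: measurableT_comp mu_ (mJx x).
  - by move=> y _; rewrite lee_fin addr_ge0// mulr_ge0.
  - apply: emeasurable_funD => //; apply/measurable_EFinP; apply: measurable_funM => //.
    exact: measurableT_comp mQ (mJx x).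
  - by apply: filterS uQ => y uQ _; rewrite /= lee_fin -mulrDr ler_wpM2l.
have bQ2 : ebounded mu (fun x => 2^-1 * Q x) by exact: eboundedZ.
have EE x : Num.sqrt (fine (E x)) ^+ 2 = fine (E x) by rewrite sqr_sqrtr// fine_ge0.
under eq_integral do rewrite -/(E _) EE.
apply: (@le_trans _ _ (\int[mu]_x ((2^-1 * Q x)%:E + F x))%E).
  apply: ae_ge0_le_integral => //.
  - by move=> x _; rewrite lee_fin fine_ge0.
  - by apply/measurable_EFinP; apply: (measurableT_comp (f := fine)) => //; exact: fine_measurable.
  - by move=> x _; rewrite adde_ge0// lee_fin mulr_ge0.
  - by apply: emeasurable_funD => //; apply/measurable_EFinP; exact: bQ2.1.
  - apply: filterS EF => x EF _; apply: le_trans EF.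
    (* Passing through [fine] can only lower a nonnegative value, as it sends [+oo] to 0. *)
    have := E0 x; by case: (E x) => [r| |] //= _; rewrite ?lexx ?leey.
rewrite ge0_integralD//; last 2 first.
- by move=> x _; rewrite lee_fin mulr_ge0.
- by apply/measurable_EFinP; exact: bQ2.1.
rewrite -(disint (ebounded_integrable bQ2)).
rewrite -ge0_integralD//; last 4 first.
- by move=> x _; rewrite lee_fin mulr_ge0.
- by apply/measurable_EFinP; exact: bQ2.1.
- by move=> x _; rewrite lee_fin mulr_ge0.
- by apply/measurable_EFinP; exact: bQ2.1.
rewrite le_eqVlt; apply/orP; left; apply/eqP; apply: eq_integral => x _.
by rewrite -EFinD; congr EFin; lra.
Qed.

End resampling.

(** * Moments from entropy *)

Section elementary.
Context {R : realType}.
Implicit Types a b x y : R.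

(** Convexity: the power k+1 lies above its tangent at x. It serves below as both Young's and
    Jensen's inequality, without real exponents. *)
Lemma exprS_tangent_le x y k : 0 <= x -> 0 <= y ->
  k.+1%:R * x ^+ k * y <= y ^+ k.+1 + k%:R * x ^+ k.+1.
Proof.
move=> x0 y0; elim: k => [|k ih]; first by rewrite expr0 expr1; lra.
have h := ler_wpM2l x0 ih.
have h2 : 0 <= (y ^+ k.+1 - x ^+ k.+1) * (y - x).
  have [xy|yx] := leP x y.
    by rewrite mulr_ge0// subr_ge0// lerXn2r.
  by rewrite mulr_le0// subr_le0 ?lerXn2r// ltW.
rewrite !exprS in h h2 *; rewrite -!natr1; nra.
Qed.

(** The factor of a - b is at most (k+1) max(|a|,|b|)^k; replacing the maximum by a sum gives the
    shape Q(x) + Q(J x y) required by [integral_resample_sqr_le]. *)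
Lemma subrX_sqr_le a b k :
  (a ^+ k.+1 - b ^+ k.+1) ^+ 2 <=
  k.+1%:R ^+ 2 * (a ^+ 2 ^+ k + b ^+ 2 ^+ k) * (a - b) ^+ 2.
Proof.
rewrite subrXX exprMn mulrC ler_wpM2r ?sqr_ge0//.
pose m := Num.max `|a| `|b|.
have m0 : 0 <= m by rewrite le_max normr_ge0.
have Sm : `|\sum_(i < k.+1) a ^+ (k.+1.-1 - i) * b ^+ i| <= k.+1%:R * m ^+ k.
  apply: le_trans (ler_norm_sum _ _ _) _.
  rewrite mulr_natl -[X in _ *+ X]card_ord -sumr_const; apply: ler_sum => i _.
  rewrite normrM !normrX -[X in m ^+ X](@subnK i k) -1?ltnS//.
  by rewrite exprD ler_pM ?exprn_ge0// lerXn2r ?nnegrE// le_max lexx ?orbT.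
rewrite -real_normK ?num_real//.
apply: (@le_trans _ _ ((k.+1%:R * m ^+ k) ^+ 2)).
  by rewrite lerXn2r// ?nnegrE ?mulr_ge0 ?exprn_ge0.
rewrite exprMn ler_wpM2l ?sqr_ge0// (exprAC m).
have [->|->] : m = `|a| \/ m = `|b|.
- by rewrite /m; case: (leP `|a| `|b|) => _; [right|left].
- by rewrite real_normK ?num_real// lerDl exprn_ge0// sqr_ge0.
- by rewrite real_normK ?num_real// lerDr exprn_ge0// sqr_ge0.
Qed.

Lemma ln_ge_1BV x : 0 < x -> 1 - x^-1 <= ln x.
Proof.
move=> x0; have := @le_ln1Dx R (x^-1 - 1).
rewrite addrCA subrr addr0 lnV ?posrE// => /(_ _).
rewrite ltrBrDl subrr invr_gt0 => /(_ x0); lra.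
Qed.

Lemma norm_mul_ln_le x : 0 <= x -> `|x * ln x| <= 1 + x ^+ 2.
Proof.
rewrite le_eqVlt => /predU1P[<-|x0]; first by rewrite mul0r normr0 expr2; lra.
have h1 := ln_ge_1BV x0.
have h2 : ln x <= x - 1.
  have := @le_ln1Dx R (x - 1).
  by rewrite addrCA subrr addr0 ltrBrDl subrr => /(_ x0).
have h3 : x * (1 - x^-1) <= x * ln x by rewrite ler_pM2l.
have h4 : x * ln x <= x * (x - 1) by rewrite ler_pM2l.
rewrite mulrBr mulfV ?gt_eqF// in h3.
rewrite ler_norml; apply/andP; split; nra.
Qed.

End elementary.

(** * Entropy bounds, the moment recursion and its starting point *)

Section entropy.
Context d (T : measurableType d) (R : realType) (mu : probability T R).
Implicit Types f g F G : T -> R.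

Lemma ebounded_mul_ln F : ebounded mu F -> (forall x, 0 <= F x) ->
  ebounded mu (fun x => F x * ln (F x)).
Proof.
move=> bF F0; apply: (@ebounded_le _ _ _ _ _ (fun x => 1 + F x ^+ 2)).
- apply: measurable_funM; first exact: bF.1.
  by apply: measurableT_comp => //; exact: bF.1.
- by apply: eboundedD; [exact: ebounded_cst|exact: eboundedX].
- apply: aeW => x; rewrite [leRHS]ger0_norm ?norm_mul_ln_le//.
  by rewrite addr_ge0// sqr_ge0.
Qed.

Lemma ebounded_RintegralD f g : ebounded mu f -> ebounded mu g ->
  \int[mu]_x (f x + g x) = \int[mu]_x f x + \int[mu]_x g x.
Proof. by move=> bf bg; rewrite RintegralD//; exact: ebounded_integrable. Qed.

Lemma ebounded_RintegralZ r f : ebounded mu f ->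
  \int[mu]_x (r * f x) = r * \int[mu]_x f x.
Proof. by move=> bf; rewrite RintegralZl//; exact: ebounded_integrable. Qed.

Lemma ebounded_Rintegral_sum (I : Type) (s : seq I) (P : pred I) (F : I -> T -> R) :
  (forall i, P i -> ebounded mu (F i)) ->
  \int[mu]_x (\sum_(i <- s | P i) F i x) = \sum_(i <- s | P i) \int[mu]_x F i x.
Proof.
move=> bF; elim: s => [|i s ih].
  by under eq_Rintegral do rewrite big_nil; rewrite big_nil /Rintegral integral0.
under eq_Rintegral do rewrite big_cons.
rewrite big_cons; case: (P i) (bF i) => // /(_ isT) bFi.
by rewrite ebounded_RintegralD ?ih//; exact: ebounded_sum.
Qed.

Lemma prob_Rintegral_cst r : \int[mu]_x r = r.
Proof. by rewrite Rintegral_cst// [X in fine X]probability_setT mulr1. Qed.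

(* Integrates F^k ln (F/t) >= F^k - t F^(k-1) with t = N^k / T0^(k-1), where k stands for k.+2. *)
Lemma entropy_lower_bound F k (N T0 : R) : ebounded mu F -> (forall x, 0 <= F x) ->
  0 < N -> 0 < T0 ->
  \int[mu]_x (F x ^+ k.+2) = N ^+ k.+2 -> \int[mu]_x (F x ^+ k.+1) <= T0 ^+ k.+1 ->
  k.+2%:R * k.+1%:R * N ^+ k.+1 * (N - T0) <=
  \int[mu]_x (F x ^+ k.+2 * ln (F x ^+ k.+2)) - N ^+ k.+2 * ln (N ^+ k.+2).
Proof.
move=> bF F0 N0 T0_gt0 EN ET.
pose t := N ^+ k.+2 / T0 ^+ k.+1.
have t0 : 0 < t by rewrite divr_gt0// exprn_gt0.
have bX j : ebounded mu (fun x => F x ^+ j) by exact: eboundedX.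
have pw x : k.+2%:R * ((ln t + 1) * F x ^+ k.+2 + - t * F x ^+ k.+1) <=
    F x ^+ k.+2 * ln (F x ^+ k.+2).
  have := F0 x; rewrite le_eqVlt => /predU1P[<-|Fx0].
    by rewrite !exprS !mul0r !mulr0 addr0 mulr0.
  rewrite lnXn// -[ln (F x) *+ _]mulr_natl [F x ^+ _ * _]mulrCA ler_wpM2l//.
  have /ln_ge_1BV : 0 < F x / t by rewrite divr_gt0.
  rewrite ln_div ?posrE// invf_div => h.
  have := ler_wpM2l (exprn_ge0 k.+2 (F0 x)) h.
  have -> : F x ^+ k.+2 * (1 - t / F x) = F x ^+ k.+2 - t * F x ^+ k.+1.
    rewrite mulrBr mulr1; congr (_ - _); rewrite exprSr -mulrA [t / _]mulrC mulVKf ?gt_eqF//.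
    exact: mulrC.
  lra.
have h : k.+2%:R * ((ln t + 1) * N ^+ k.+2 - t * \int[mu]_x (F x ^+ k.+1)) <=
    \int[mu]_x (F x ^+ k.+2 * ln (F x ^+ k.+2)).
  rewrite -mulNr -EN -!ebounded_RintegralZ// -ebounded_RintegralD; try exact: eboundedZ.
  rewrite -ebounded_RintegralZ; last by apply: eboundedD; exact: eboundedZ.
  apply: le_Rintegral => //; apply: ebounded_integrable.
    by apply: eboundedZ; apply: eboundedD; exact: eboundedZ.
  by apply: ebounded_mul_ln => // x; exact: exprn_ge0.
(* By the choice of [t] this term is absorbed by the [+ 1] next to [ln t], leaving only the
   logarithm. *)
have tT : t * \int[mu]_x (F x ^+ k.+1) <= N ^+ k.+2.
  apply: (@le_trans _ _ (t * T0 ^+ k.+1)); first by rewrite ler_pM2l.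
  by rewrite /t divfK// gt_eqF// exprn_gt0.
have h2 : k.+2%:R * (ln t * N ^+ k.+2) <= \int[mu]_x (F x ^+ k.+2 * ln (F x ^+ k.+2)).
  apply: le_trans h; rewrite ler_wpM2l//; lra.
have lt : ln t = k.+2%:R * ln N - k.+1%:R * ln T0.
  by rewrite /t ln_div ?posrE ?exprn_gt0// !lnXn// !mulr_natl.
have NT : 1 - T0 / N <= ln N - ln T0.
  have := @ln_ge_1BV R (N / T0); rewrite divr_gt0// => /(_ isT).
  by rewrite ln_div ?posrE// invf_div.
apply: (@le_trans _ _ (k.+2%:R * (ln t * N ^+ k.+2) - N ^+ k.+2 * ln (N ^+ k.+2))); last first.
  by rewrite lerD2r.
rewrite lt lnXn// -[ln N *+ _]mulr_natl.
have -> : k.+2%:R * ((k.+2%:R * ln N - k.+1%:R * ln T0) * N ^+ k.+2) -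
    N ^+ k.+2 * (k.+2%:R * ln N) =
    k.+2%:R * k.+1%:R * N ^+ k.+2 * (ln N - ln T0).
  rewrite -(natr1 k.+1); ring.
have -> : k.+2%:R * k.+1%:R * N ^+ k.+1 * (N - T0) =
   k.+2%:R * k.+1%:R * N ^+ k.+2 * (1 - T0 / N).
  rewrite -mulrA -[RHS]mulrA; congr (_ * _); rewrite [in RHS]exprSr -mulrA; congr (_ * _).
  by rewrite mulrBr mulr1 mulrCA divff ?mulr1// gt_eqF.
apply: ler_wpM2l NT.
have Nk : 0 <= N ^+ k.+2 by rewrite exprn_ge0// ltW.
by apply: mulr_ge0 => //; exact: mulr_ge0.
Qed.

(** Hölder with exponents (k+1)/k and k+1: integrate the tangent inequality at x = M F, y = N G,
    whose scaling makes both sides homogeneous, and divide by (k+1) M^k N. *)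
Lemma young_moment F G k (N M : R) : ebounded mu F -> ebounded mu G ->
  (forall x, 0 <= F x) -> (forall x, 0 <= G x) -> 0 < N -> 0 < M ->
  \int[mu]_x (F x ^+ k.+1) <= N ^+ k.+1 -> \int[mu]_x (G x ^+ k.+1) <= M ^+ k.+1 ->
  \int[mu]_x (F x ^+ k * G x) <= N ^+ k * M.
Proof.
move=> bF bG F0 G0 N0 M0 EF EG.
have bFG : ebounded mu (fun x => F x ^+ k * G x) by apply: eboundedM => //; exact: eboundedX.
have bX j : ebounded mu (fun x => F x ^+ j) by exact: eboundedX.
have bY j : ebounded mu (fun x => G x ^+ j) by exact: eboundedX.
have c0 : 0 < k.+1%:R * M ^+ k * N by rewrite !mulr_gt0// exprn_gt0.
rewrite -(ler_pM2l c0) -ebounded_RintegralZ//.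
apply: (@le_trans _ _ (\int[mu]_x (N ^+ k.+1 * G x ^+ k.+1 + (k%:R * M ^+ k.+1) * F x ^+ k.+1))).
  apply: le_Rintegral => //.
  - exact/ebounded_integrable/eboundedZ.
  - by apply: ebounded_integrable; apply: eboundedD; exact: eboundedZ.
  - move=> x _; have := @exprS_tangent_le R (M * F x) (N * G x) k.
    rewrite (mulr_ge0 (ltW M0))// (mulr_ge0 (ltW N0))// => /(_ isT isT).
    rewrite !exprMn => h; apply: le_trans (le_trans h _); rewrite le_eqVlt;
      apply/orP; left; apply/eqP; rewrite ?exprS; ring.
rewrite ebounded_RintegralD; [|exact: eboundedZ|exact: eboundedZ].
rewrite !ebounded_RintegralZ//.
apply: (@le_trans _ _ (N ^+ k.+1 * M ^+ k.+1 + k%:R * M ^+ k.+1 * N ^+ k.+1)).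
  by rewrite lerD// ler_wpM2l ?mulr_ge0// exprn_ge0// ltW.
by rewrite -natr1 !exprS le_eqVlt; apply/orP; left; apply/eqP; ring.
Qed.

(** With N the norm of F of order k+2, the lower and upper entropy bounds share the factor (k+2)
    N^(k+1). Dividing by it leaves an inequality linear in N; the case N = 0 is separated because of
    this division. *)
Lemma moment_step F G k (s T0 U M : R) : ebounded mu F -> ebounded mu G ->
  (forall x, 0 <= F x) -> (forall x, 0 <= G x) -> 0 < T0 -> 0 < M -> 0 <= s ->
  \int[mu]_x (F x ^+ k.+2 * ln (F x ^+ k.+2)) -
    \int[mu]_x (F x ^+ k.+2) * ln (\int[mu]_x (F x ^+ k.+2)) <=
    4 * s * k.+2%:R ^+ 2 * \int[mu]_x (F x ^+ k.+1 * G x) ->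
  \int[mu]_x (F x ^+ k.+1) <= T0 ^+ k.+1 -> \int[mu]_x (G x ^+ k.+2) <= M ^+ k.+2 ->
  4 * s * k.+2%:R * M <= k.+1%:R * (U - T0) ->
  \int[mu]_x (F x ^+ k.+2) <= U ^+ k.+2.
Proof.
move=> bF bG F0 G0 T0_gt0 M0 s0 Ent ET EG TU.
have UT : T0 <= U.
  rewrite -subr_ge0 -(pmulr_rge0 (x := k.+1%:R))//; apply: le_trans TU.
  by rewrite !mulr_ge0// ltW.
have A0 : 0 <= \int[mu]_x (F x ^+ k.+2) by apply: Rintegral_ge0 => x _; exact: exprn_ge0.
move: A0; rewrite le_eqVlt => /predU1P[<-|A0].
  by rewrite exprn_ge0// (le_trans _ UT)// ltW.
pose N := (\int[mu]_x (F x ^+ k.+2)) `^ (k.+2%:R^-1).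
have N0 : 0 < N by exact: powR_gt0.
have EN : \int[mu]_x (F x ^+ k.+2) = N ^+ k.+2.
  by rewrite -powR_mulrn ?powR_ge0// -powRrM mulVf// powRr1// ltW.
have h1 := entropy_lower_bound bF F0 N0 T0_gt0 EN ET.
have h2 := young_moment (k := k.+1) bF bG F0 G0 N0 M0.
rewrite EN lexx in h2; have {}h2 := h2 isT EG.
rewrite EN in Ent; have {}h1 := le_trans h1 Ent.
suff NU : N <= U by rewrite EN lerXn2r// nnegrE ltW// (lt_le_trans N0).
have {}h1 : k.+2%:R * k.+1%:R * N ^+ k.+1 * (N - T0) <= 4 * s * k.+2%:R ^+ 2 * (N ^+ k.+1 * M).
  by apply: le_trans h1 _; rewrite ler_wpM2l// !mulr_ge0// ?sqr_ge0.
have {}h1 : k.+1%:R * (N - T0) <= 4 * s * k.+2%:R * M.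
  have c0 : 0 < k.+2%:R * N ^+ k.+1 by rewrite mulr_gt0// exprn_gt0.
  rewrite -(ler_pM2l c0); apply: le_trans (le_trans h1 _); rewrite le_eqVlt;
    apply/orP; left; apply/eqP; ring.
by have := le_trans h1 TU; rewrite ler_pM2l// lerD2r.
Qed.

(* The constant 6: the recursion adds 4 j/(j-1) <= 6 at each step j >= 3, and 4 + 8 = 2 * 6. *)
Lemma moment_iteration F G K (s M : R) : ebounded mu F -> ebounded mu G ->
  (forall x, 0 <= F x) -> (forall x, 0 <= G x) -> 0 < M -> 0 < s ->
  (forall k, \int[mu]_x (F x ^+ k.+2 * ln (F x ^+ k.+2)) -
    \int[mu]_x (F x ^+ k.+2) * ln (\int[mu]_x (F x ^+ k.+2)) <=
    4 * s * k.+2%:R ^+ 2 * \int[mu]_x (F x ^+ k.+1 * G x)) ->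
  \int[mu]_x F x <= 4 * s * M ->
  (forall k, (k < K)%N -> \int[mu]_x (G x ^+ k.+1) <= M ^+ k.+1) ->
  forall k, (k < K)%N -> \int[mu]_x (F x ^+ k.+1) <= (6 * k.+1%:R * s * M) ^+ k.+1.
Proof.
move=> bF bG F0 G0 M0 s0 Ent EF EG.
have sM : 0 < s * M by rewrite mulr_gt0.
elim=> [|[|k] ih] kK.
- under eq_Rintegral do rewrite expr1.
  by rewrite expr1; apply: le_trans EF _; lra.
(* The sharper initial bound 4 s M is used again: starting from the induction bound 6 s M would give
   14 instead of 12. *)
- have T0 : 0 < 4 * s * M by rewrite -mulrA mulr_gt0.
  apply: (@moment_step F G 0 s (4 * s * M) _ M bF bG F0 G0 T0 M0 (ltW s0)) => //.
  + exact: EG.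
  + lra.
- have {}ih := ih (ltnW kK).
  apply: (@moment_step F G k.+1 s _ _ M bF bG F0 G0 _ M0 (ltW s0) _ ih) => //.
  + by rewrite -!mulrA !mulr_gt0.
  + exact: EG.
  + have k0 : 0 <= k%:R :> R by [].
    have -> : k.+3%:R = k%:R + 3 :> R by rewrite -addn3 natrD.
    have -> : k.+2%:R = k%:R + 2 :> R by rewrite -addn2 natrD.
    have := mulr_ge0 k0 (ltW sM); nra.
Qed.

(* The entropy hypothesis is the log-Sobolev inequality at 1 + e f; (1+t)^2 ln (1+t)^2 >= 2t + 2t^2
   linearises it as e -> 0 (losing a factor 2). *)
Lemma poincare f G (s : R) : ebounded mu f -> ebounded mu G -> 0 <= s ->
  (forall x, 0 <= G x) -> \int[mu]_x f x = 0 ->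
  (forall e : R, \int[mu]_x ((1 + e * f x) ^+ 2 * ln ((1 + e * f x) ^+ 2)) -
    \int[mu]_x ((1 + e * f x) ^+ 2) * ln (\int[mu]_x ((1 + e * f x) ^+ 2)) <=
    2 * s * e ^+ 2 * \int[mu]_x G x) ->
  \int[mu]_x (f x ^+ 2) <= 2 * s * \int[mu]_x G x.
Proof.
move=> bf bG s0 G0 Ef Ent; pose v := \int[mu]_x (f x ^+ 2).
have v0 : 0 <= v by apply: Rintegral_ge0 => x _; exact: sqr_ge0.
have bf2 : ebounded mu (fun x => f x ^+ 2) by exact: eboundedX.
have [_ [B fB]] := bf.
apply/ler_addgt0Pr => dl dl0; rewrite -/v.
(* Small enough e: the first summand keeps 1 + e f at least 1/2, the second gives e <= 1, and the
   third bounds the error e^2 v^2 by [dl]. *)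
pose c := 2 * `|B| + 1 + v ^+ 2 / dl; pose e := c^-1.
have vd0 : 0 <= v ^+ 2 / dl by rewrite divr_ge0 ?sqr_ge0// ltW.
have c1 : 1 <= c by have := normr_ge0 B; rewrite /c; lra.
have c0 : 0 < c by lra.
have e0 : 0 < e by rewrite invr_gt0.
have e1 : e <= 1 by rewrite invf_le1.
have ev : e * v ^+ 2 <= dl.
  rewrite mulrC ler_pdivrMr// mulrC -ler_pdivrMr// /c; have := normr_ge0 B; lra.
have eB : e * `|B| <= 2^-1.
  by rewrite mulrC ler_pdivrMr// /c; lra.
have a1 : \int[mu]_x ((1 + e * f x) ^+ 2) = 1 + e ^+ 2 * v.
  transitivity (\int[mu]_x (1 + (2 * e * f x + e ^+ 2 * f x ^+ 2))).
    by apply: eq_Rintegral => x _; ring.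
  rewrite ebounded_RintegralD; [|exact: ebounded_cst|by apply: eboundedD; exact: eboundedZ].
  rewrite prob_Rintegral_cst ebounded_RintegralD; [|exact: eboundedZ|exact: eboundedZ].
  by rewrite !ebounded_RintegralZ// Ef mulr0 add0r.
have bu : ebounded mu (fun x => (1 + e * f x) ^+ 2).
  by apply: eboundedX; apply: eboundedD; [exact: ebounded_cst|exact: eboundedZ].
have lb : 2 * e ^+ 2 * v <= \int[mu]_x ((1 + e * f x) ^+ 2 * ln ((1 + e * f x) ^+ 2)).
  have -> : 2 * e ^+ 2 * v = \int[mu]_x (2 * e * f x + 2 * e ^+ 2 * f x ^+ 2).
    rewrite ebounded_RintegralD; [|exact: eboundedZ|exact: eboundedZ].
    by rewrite !ebounded_RintegralZ// Ef mulr0 add0r.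
  apply: le_Rintegral_ae.
  - by apply: ebounded_integrable; apply: eboundedD; exact: eboundedZ.
  - by apply: ebounded_integrable; apply: ebounded_mul_ln => // x; exact: sqr_ge0.
  - apply: filterS fB => x fB.
    have u0 : 0 < 1 + e * f x.
      have : `|e * f x| <= 2^-1.
        rewrite normrM gtr0_norm//; apply: le_trans eB.
        by rewrite ler_wpM2l ?(ltW e0)// (le_trans fB)// ler_norm.
      by rewrite ler_norml => /andP[? ?]; lra.
    rewrite lnXn// -[ln _ *+ 2]mulr_natl.
    have := ler_wpM2l (sqr_ge0 (1 + e * f x)) (ln_ge_1BV u0).
    rewrite mulrBr mulr1 {2}expr2 mulfK ?gt_eqF//; nra.
have ub : (1 + e ^+ 2 * v) * ln (1 + e ^+ 2 * v) <= (1 + e ^+ 2 * v) * (e ^+ 2 * v).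
  have ev0 : 0 <= e ^+ 2 * v by rewrite mulr_ge0// sqr_ge0.
  by rewrite ler_wpM2l ?addr_ge0// le_ln1Dx// (lt_le_trans _ ev0)// oppr_lt0.
have := Ent e; rewrite a1 => he.
have : e ^+ 2 * (v - e ^+ 2 * v ^+ 2) <= e ^+ 2 * (2 * s * \int[mu]_x G x) by lra.
rewrite ler_pM2l ?exprn_gt0// => hv.
have : e ^+ 2 * v ^+ 2 <= dl.
  apply: le_trans ev; rewrite ler_wpM2r ?sqr_ge0// expr2.
  by rewrite ger_pMr.
lra.
Qed.

Lemma Lnorm2_le f (r : R) : 0 <= r -> ebounded mu f ->
  (Lnorm mu 2%:E (EFin \o f) <= r%:E)%E -> \int[mu]_x (f x ^+ 2) <= r ^+ 2.
Proof.
move=> r0 bf fr.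
have : (Lnorm mu 2%:E (EFin \o f) `^ 2 <= r%:E `^ 2)%E.
  by apply: gt0_ler_poweR => //; rewrite in_itv/= ?Lnorm_ge0 ?leey ?lee_fin ?r0.
rewrite poweR_Lnorm ?pnatr_eq0// poweR_EFin powR_mulrn//.
have -> : (\int[mu]_x (`|(EFin \o f) x| `^ 2) = \int[mu]_x (f x ^+ 2)%:E)%E.
  by apply: eq_integral => x _ /=; rewrite powR_mulrn// real_normK// num_real.
by rewrite -ebounded_fineK ?lee_fin//; exact: eboundedX.
Qed.

End entropy.

(** * From moments to the exponential moment *)

Section exponential_moment.
Context d (T : measurableType d) (R : realType) (mu : probability T R).

(* Jensen for the power n.+1, through the tangent line at W^k. *)
Lemma moment_root (V : T -> R) (W : R) k n : measurable_fun setT V ->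
  (forall x, 0 <= V x) -> ebounded mu (fun x => V x ^+ k) -> 0 < W ->
  \int[mu]_x (V x ^+ (k * n.+1)) <= W ^+ (k * n.+1) ->
  \int[mu]_x (V x ^+ k) <= W ^+ k.
Proof.
move=> mV V0 bV W0 EV.
have c0 : 0 < n.+1%:R * W ^+ (k * n) by rewrite mulr_gt0// exprn_gt0.
rewrite -(ler_pM2l c0) -ebounded_RintegralZ//.
apply: (@le_trans _ _ (\int[mu]_x (V x ^+ (k * n.+1) + n%:R * W ^+ (k * n.+1)))).
  have bVn : ebounded mu (fun x => V x ^+ (k * n.+1)).
    by under eq_fun do rewrite exprM; exact: eboundedX.
  apply: le_Rintegral => //.
  - exact/ebounded_integrable/eboundedZ.
  - by apply: ebounded_integrable; apply: eboundedD => //; exact: ebounded_cst.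
  - move=> x _; rewrite !exprM; apply: exprS_tangent_le; apply: exprn_ge0 => //.
    exact: ltW.
rewrite ebounded_RintegralD; [|by under eq_fun do rewrite exprM; exact: eboundedX|
  exact: ebounded_cst].
rewrite prob_Rintegral_cst -lerBrDr; apply: le_trans EV _.
rewrite le_eqVlt; apply/orP; left; apply/eqP.
rewrite !exprM [W ^+ k ^+ n.+1]exprSr -natr1; ring.
Qed.

(** k^k / k! is one term of the series of e^k. *)
Lemma natr_expr_le_fact k : (k%:R : R) ^+ k <= expR 1 ^+ k * k`!%:R.
Proof.
case: k => [|k]; first by rewrite !expr0 mul1r.
have := @expR_ge1Dxn R k.+1%:R k (ler0n _ _).
rewrite -[X in expR X]mulr1 expRM_natl => h.
rewrite -ler_pdivrMr ?ltr0n ?fact_gt0//; apply: le_trans h.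
by rewrite lerDr.
Qed.

(** The k-th term of the integrated exponential series is at most (c w e)^k <= 2^-k, with total 2.
    All terms are nonnegative, so the exchange of sum and integral needs no prior integrability of
    the exponential. *)
Lemma expR_moment_le2 (V : T -> R) (w c : R) : measurable_fun setT V ->
  (forall x, 0 <= V x) -> 0 <= w -> 0 <= c -> c * w * expR 1 <= 2^-1 ->
  (forall k, (\int[mu]_x (V x ^+ k.+1)%:E <= ((k.+1%:R * w) ^+ k.+1)%:E)%E) ->
  (\int[mu]_x (expR (c * V x))%:E <= 2%:E)%E.
Proof.
move=> mV V0 w0 c0 cw EV.
have ex x : ((expR (c * V x))%:E = \sum_(0 <= k <oo) (exp_coeff (c * V x) k)%:E)%E.
  rewrite /expR -EFin_lim; last exact: is_cvg_series_exp_coeff.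
  by congr (limn _); apply/funext => k; rewrite /= sumEFin.
under eq_integral do rewrite ex.
rewrite integral_nneseries//; last 2 first.
- move=> k; apply/measurable_EFinP; rewrite /exp_coeff; apply: measurable_funM => //.
  by apply: measurable_funX; exact: measurable_funM.
- by move=> k x _; rewrite lee_fin exp_coeff_ge0// mulr_ge0.
apply: (@le_trans _ _ (\sum_(0 <= k <oo) (2^-1 ^+ k)%:E)%E).
  apply: lee_nneseries => [k _ _|k _].
    by apply: integral_ge0 => x _; rewrite lee_fin exp_coeff_ge0// mulr_ge0.
  have -> : (\int[mu]_x (exp_coeff (c * V x) k)%:E =
     (c ^+ k / k`!%:R)%:E * \int[mu]_x (V x ^+ k)%:E)%E.
    rewrite -ge0_integralZl_EFin//.
    - by apply: eq_integral => x _; rewrite -EFinM /exp_coeff/= exprMn mulrAC.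
    - by move=> x _; rewrite lee_fin exprn_ge0.
    - by apply/measurable_EFinP; exact: measurable_funX.
    - by rewrite divr_ge0// exprn_ge0.
  case: k => [|k].
    rewrite !expr0 fact0 divr1 mul1e.
    under eq_integral do rewrite expr0.
    by rewrite integral_cst// [X in (_ * X)%E]probability_setT mule1.
  apply: (@le_trans _ _ ((c ^+ k.+1 / k.+1`!%:R)%:E * ((k.+1%:R * w) ^+ k.+1)%:E)%E).
    by apply: lee_wpmul2l; [rewrite lee_fin divr_ge0// exprn_ge0|exact: EV].
  rewrite -EFinM lee_fin mulrAC ler_pdivrMr ?ltr0n ?fact_gt0// exprMn.
  apply: (@le_trans _ _ (c ^+ k.+1 * ((expR 1 ^+ k.+1 * k.+1`!%:R) * w ^+ k.+1))).
    rewrite ler_wpM2l ?exprn_ge0// ler_wpM2r ?exprn_ge0//.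
    exact: natr_expr_le_fact.
  have -> : c ^+ k.+1 * ((expR 1 ^+ k.+1 * k.+1`!%:R) * w ^+ k.+1) =
     (c * w * expR 1) ^+ k.+1 * k.+1`!%:R.
    by rewrite !exprMn; ring.
  rewrite ler_wpM2r// lerXn2r// ?nnegrE ?mulr_ge0 ?expR_ge0//.
(* The sum of 2^-k, written with terms 2 / 2^(k+1) to match [cvg_geometric_eseries_half]. *)
rewrite -[leRHS](_ : limn (eseries (fun k => (2 / (2 ^ (k + 1))%:R)%:E)) = _); last first.
  by apply/cvg_lim => //; have := @cvg_geometric_eseries_half R 2 0; rewrite expr0 divr1.
rewrite le_eqVlt; apply/orP; left; apply/eqP; congr (limn _); apply/funext => k.
by apply: eq_bigr => i _; rewrite addn1 expnS natrM natrX invfM mulVKf// exprVn.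
Qed.

End exponential_moment.

(** * Higher-order differences *)

Lemma cauchy_schwarz_sum (R : realType) (I : finType) (P : pred I) (a b : I -> R) :
  \sum_(i | P i) a i * b i <=
  Num.sqrt (\sum_(i | P i) a i ^+ 2) * Num.sqrt (\sum_(i | P i) b i ^+ 2).
Proof.
have s0 (c : I -> R) : 0 <= \sum_(i | P i) c i ^+ 2 by apply: sumr_ge0 => i _; exact: sqr_ge0.
set A := Num.sqrt _; set B := Num.sqrt _.
have A0 : 0 <= A by exact: sqrtr_ge0.
have B0 : 0 <= B by exact: sqrtr_ge0.
have zero (c : I -> R) : Num.sqrt (\sum_(i | P i) c i ^+ 2) = 0 -> forall i, P i -> c i = 0.
  move=> /eqP; rewrite sqrtr_eq0 => c0.
  have /eqP : \sum_(i | P i) c i ^+ 2 = 0 by apply/eqP; rewrite eq_le c0 s0.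
  rewrite psumr_eq0; last by move=> i _; exact: sqr_ge0.
  by move=> /allP h i Pi; have := h i (mem_index_enum _); rewrite Pi sqrf_eq0 => /eqP.
have [A00|A00] := eqVneq A 0.
  by rewrite A00 mul0r big1// => i Pi; rewrite (zero a)// mul0r.
have [B00|B00] := eqVneq B 0.
  by rewrite B00 mulr0 big1// => i Pi; rewrite (zero b)// mulr0.
have AB0 : 0 < 2 * (A * B) by rewrite !mulr_gt0// lt_neqAle eq_sym ?A00 ?B00.
rewrite -(ler_pM2l AB0) mulr_sumr.
apply: (@le_trans _ _ (\sum_(i | P i) (B ^+ 2 * a i ^+ 2 + A ^+ 2 * b i ^+ 2))).
  apply: ler_sum => i _; have := sqr_ge0 (B * a i - A * b i); nra.
rewrite big_split/= -!mulr_sumr.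
have <- : A ^+ 2 = \sum_(i | P i) a i ^+ 2 by rewrite sqr_sqrtr.
have <- : B ^+ 2 = \sum_(i | P i) b i ^+ 2 by rewrite sqr_sqrtr.
lra.
Qed.

(** Reverse triangle inequality for the Euclidean norm; it lies behind h |h^(l) f| <= |h^(l+1)
    f|. *)
Lemma sqrt_sum_sqr_dist (R : realType) (I : finType) (P : pred I) (a b : I -> R) :
  (Num.sqrt (\sum_(i | P i) a i ^+ 2) - Num.sqrt (\sum_(i | P i) b i ^+ 2)) ^+ 2 <=
  \sum_(i | P i) (a i - b i) ^+ 2.
Proof.
have s0 (c : I -> R) : 0 <= \sum_(i | P i) c i ^+ 2 by apply: sumr_ge0 => i _; exact: sqr_ge0.
have := cauchy_schwarz_sum P a b.
under [X in _ -> _ <= X]eq_bigr => i _ do rewrite sqrrB.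
rewrite big_split sumrB/= sqrrB !sqr_sqrtr// sumrMnl; lra.
Qed.

Lemma sum_tuple_cons (R : realType) (T : finType) (P : pred T) l
    (g : seq T -> R) :
  \sum_(t : l.+1.-tuple T | all P t) g t =
  \sum_(i | P i) \sum_(t : l.-tuple T | all P t) g (i :: t).
Proof.
rewrite pair_big/= (reindex (fun p : T * l.-tuple T => [tuple of p.1 :: p.2])) //=.
exists (fun t : l.+1.-tuple T => (thead t, [tuple of behead t])).
  by move=> [i t] _ /=; congr (_, _); apply: val_inj.
by move=> t _ /=; rewrite [RHS]tuple_eta.
Qed.

(** * The resampling results for the blocks of the theorem *)

Section blocks.
Context (R : realType) (n : nat) (S : 'I_n -> completePseudoMetricType R).
Hypothesis HS : forall i, polish (S i).
Local Notation BS := (BorelS S).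
Context (mu : probability BS R) (II : {set {set 'I_n}})
  (m : {set 'I_n} -> BS -> probability BS R).
Hypothesis Hm : forall I, I \in II -> disintegration mu I (m I).

Lemma join_join I (x y z : BS) : join I (join I x y) z = join I x z.
Proof. by apply: functional_extensionality_dep => i; rewrite /join; case: (i \in I). Qed.

Lemma kernel_join I x y : I \in II -> m I (join I x y) = m I x.
Proof.
by move=> /Hm[_ h _]; apply: h => i /negbTE iI; rewrite /join iI.
Qed.

Let mmI I : I \in II -> forall A, measurable A ->
  measurable_fun setT ((fun x => m I x A) : BS -> \bar R).
Proof. by move=> /Hm[]. Qed.

Let disI I : I \in II -> forall g : BS -> R, mu.-integrable setT (EFin \o g) ->
  (\int[mu]_x (g x)%:E = \int[mu]_x \int[m I x]_y (g (join I x y))%:E)%E.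
Proof. by move=> /Hm[]. Qed.

Lemma ebounded_hI I f : I \in II -> ebounded mu f -> ebounded mu (hI m I f).
Proof.
move=> II_I bf.
exact: (ebounded_oscillation (mmI II_I) (measurable_join I HS) (disI II_I) bf).
Qed.

Lemma ae_hI I f : I \in II -> ebounded mu f ->
  \forall x \ae mu, \forall y \ae m I x, (f x - f (join I x y)) ^+ 2 <= 2 * hI m I f x ^+ 2.
Proof.
move=> II_I bf.
exact: (ae_oscillation_resample (mmI II_I) (measurable_join I HS) (@join_join I)
  (fun x y => kernel_join x y II_I) (disI II_I) bf).
Qed.

Lemma hI_join I f x y : I \in II -> hI m I f (join I x y) = hI m I f x.
Proof.
move=> II_I.
exact: (oscillation_resample (@join_join I) (fun x y => kernel_join x y II_I)).
Qed.

Lemma ebounded_hseq (s : seq {set 'I_n}) f : all (fun I => I \in II) s -> ebounded mu f ->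
  ebounded mu (hseq m s f).
Proof.
by move=> sII bf; elim: s sII => //= I s ih /andP[II_I /ih]; exact: ebounded_hI.
Qed.

Lemma measurable_partialI_sqr I u : I \in II -> measurable_fun setT u ->
  measurable_fun setT (fun x => partialI m I u x ^+ 2).
Proof.
move=> II_I mu_.
have -> : (fun x => partialI m I u x ^+ 2) =
    fine \o (fun x => \int[m I x]_y (2^-1 * (u x - u (join I x y)) ^+ 2)%:E)%E.
  apply/funext => x; rewrite /partialI sqr_sqrtr// fine_ge0// integral_ge0// => y _.
  by rewrite lee_fin mulr_ge0// sqr_ge0.
apply: measurableT_comp; first exact: fine_measurable.
apply: (measurable_fun_integral_prob (k := m I)
  (phi := fun p => (2^-1 * (u p.1 - u (join I p.1 p.2)) ^+ 2)%:E)).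
- exact: mmI.
- by move=> p; rewrite lee_fin mulr_ge0// sqr_ge0.
- apply/measurable_EFinP; apply: measurable_funM => //; apply: measurable_funX.
  apply: measurable_funB; first exact: measurableT_comp mu_ measurable_fst.
  exact: measurableT_comp mu_ (measurable_join I HS).
Qed.

(** * Consequences of the log-Sobolev inequality *)

Variable sigma2 : R.
Hypothesis sigma2_ge0 : 0 <= sigma2.
Hypothesis HLSI : LSI m mu II sigma2.

Lemma block_entropy_le u (Q : {set 'I_n} -> BS -> R) : ebounded mu u ->
  (forall I, I \in II -> ebounded mu (Q I)) -> (forall I x, 0 <= Q I x) ->
  (forall I, I \in II -> \forall x \ae mu, \forall y \ae m I x,
    (u x - u (join I x y)) ^+ 2 <= Q I x + Q I (join I x y)) ->
  Ent mu (fun x => u x ^+ 2) <= 2 * sigma2 * \sum_(I in II) \int[mu]_x Q I x.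
Proof.
move=> bu bQ Q0 uQ.
have /HLSI/le_trans : Linfty mu u by split; [exact: bu.1|apply/Linfty_ebounded; [exact: bu.1|exact: bu.2]].
apply; rewrite ler_wpM2l ?mulr_ge0//.
have le : (\int[mu]_x (gradnorm m II u x ^+ 2)%:E <= (\sum_(I in II) \int[mu]_x Q I x)%:E)%E.
  have -> : (\int[mu]_x (gradnorm m II u x ^+ 2)%:E =
      \sum_(I in II) \int[mu]_x (partialI m I u x ^+ 2)%:E)%E.
    (* Extended by zero outside [II]: the exchange of sum and integral asks for measurability at
       every index, which [partialI] is known to have only for blocks of [II]. *)
    pose g I x := if I \in II then (partialI m I u x ^+ 2)%:E else 0%E.
    transitivity (\int[mu]_x (\sum_I g I x)%R)%E.
      apply: eq_integral => x _; rewrite /gradnorm sqr_sqrtr; last first.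
        by apply: sumr_ge0 => I _; exact: sqr_ge0.
      by rewrite -sumEFin big_mkcond.
    rewrite ge0_integral_sum//; last 2 first.
    - move=> I; rewrite /g; case: (boolP (I \in II)) => // II_I.
      by apply/measurable_EFinP; apply: measurable_partialI_sqr => //; exact: bu.1.
    - by move=> I x _; rewrite /g; case: ifPn => // _; rewrite lee_fin sqr_ge0.
    rewrite [RHS]big_mkcond; apply: eq_bigr => I _; rewrite /g.
    by case: (boolP (I \in II)) => // _; exact: integral0.
  rewrite -sumEFin; apply: lee_sum => I II_I.
  rewrite (ebounded_fineK (bQ I II_I)).
  exact: (integral_resample_sqr_le (mmI II_I) (measurable_join I HS) (disI II_I) bu
    (bQ I II_I) (Q0 I) (uQ I II_I)).
rewrite -lee_fin; apply: le_trans le; rewrite /Exp.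
have : (0 <= \int[mu]_x (gradnorm m II u x ^+ 2)%:E)%E.
  by apply: integral_ge0 => x _; rewrite lee_fin sqr_ge0.
by case: (integral _ _ _) => [r| |] //= _; rewrite ?lexx ?leey.
Qed.

(** Log-Sobolev applied to u = f^(k+2), with [subrX_sqr_le] as pointwise bound; invariance of [H]
    under resampling turns it into Q(x) + Q(J x y). [H] stays abstract to cover both (h_I f)^2 for
    the centred function and the majorant of (h_I |h^(l) f|)^2. *)
Lemma block_moment_iteration f (H : {set 'I_n} -> BS -> R) K (M : R) :
  0 < sigma2 -> ebounded mu f -> (forall I, I \in II -> ebounded mu (H I)) ->
  (forall I x, 0 <= H I x) ->
  (forall I x y, I \in II -> H I (join I x y) = H I x) ->
  (forall I, I \in II -> \forall x \ae mu, \forall y \ae m I x,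
    (f x - f (join I x y)) ^+ 2 <= 2 * H I x) -> 0 < M ->
  (forall k, (k < K)%N -> \int[mu]_x ((\sum_(I in II) H I x) ^+ k.+1) <= M ^+ k.+1) ->
  \int[mu]_x (f x ^+ 2) <= 4 * sigma2 * M ->
  forall k, (k < K)%N ->
    \int[mu]_x ((f x ^+ 2) ^+ k.+1) <= (6 * k.+1%:R * sigma2 * M) ^+ k.+1.
Proof.
move=> s0 bf bH H0 HJ fH M0 EG EF.
have bG : ebounded mu (fun x => \sum_(I in II) H I x) by exact: ebounded_sum.
have bF : ebounded mu (fun x => f x ^+ 2) by exact: eboundedX.
have G0 x : 0 <= \sum_(I in II) H I x by apply: sumr_ge0.
apply: (moment_iteration bF bG (fun x => sqr_ge0 (f x)) G0 M0 s0 _ EF EG) => k.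
pose Q I x := 2 * k.+2%:R ^+ 2 * ((f x ^+ 2) ^+ k.+1 * H I x).
have bQ I : I \in II -> ebounded mu (fun x => (f x ^+ 2) ^+ k.+1 * H I x).
  by move=> II_I; apply: eboundedM (bH _ II_I); exact: eboundedX.
have hE : Ent mu (fun x => (f x ^+ k.+2) ^+ 2) <= 2 * sigma2 * \sum_(I in II) \int[mu]_x Q I x.
  apply: block_entropy_le.
  - exact: eboundedX.
  - by move=> I II_I; apply: eboundedZ; exact: bQ.
  - by move=> I x; rewrite !mulr_ge0// ?sqr_ge0// exprn_ge0// sqr_ge0.
  - move=> I II_I; apply: filterS (fH I II_I) => x; apply: filterS => y fxy.
    apply: le_trans (subrX_sqr_le _ _ _) _.
    rewrite /Q HJ//; set a := f x ^+ 2 ^+ _; set b := f _ ^+ 2 ^+ _.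
    have ab0 : 0 <= k.+2%:R ^+ 2 * (a + b).
      by rewrite mulr_ge0 ?sqr_ge0// addr_ge0// exprn_ge0// sqr_ge0.
    have := ler_wpM2l ab0 fxy; lra.
have E1 : (fun x => (f x ^+ k.+2) ^+ 2) = (fun x => (f x ^+ 2) ^+ k.+2).
  by apply/funext => x; exact: exprAC.
rewrite E1 in hE; apply: le_trans hE _.
rewrite le_eqVlt; apply/orP; left; apply/eqP.
under [in RHS]eq_Rintegral do rewrite mulr_sumr.
rewrite ebounded_Rintegral_sum// !mulr_sumr; apply: eq_bigr => I II_I.
rewrite /Q (ebounded_RintegralZ _ (bQ I II_I)); ring.
Qed.

Lemma block_poincare f (H : {set 'I_n} -> BS -> R) :
  ebounded mu f -> (forall I, I \in II -> ebounded mu (H I)) ->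
  (forall I x, 0 <= H I x) ->
  (forall I x y, I \in II -> H I (join I x y) = H I x) ->
  (forall I, I \in II -> \forall x \ae mu, \forall y \ae m I x,
    (f x - f (join I x y)) ^+ 2 <= 2 * H I x) ->
  \int[mu]_x f x = 0 ->
  \int[mu]_x (f x ^+ 2) <= 2 * sigma2 * \int[mu]_x (\sum_(I in II) H I x).
Proof.
move=> bf bH H0 HJ fH Ef.
have bG : ebounded mu (fun x => \sum_(I in II) H I x) by exact: ebounded_sum.
have G0 x : 0 <= \sum_(I in II) H I x by apply: sumr_ge0.
apply: (poincare bf bG sigma2_ge0 G0 Ef) => e.
have hE : Ent mu (fun x => (1 + e * f x) ^+ 2) <=
    2 * sigma2 * \sum_(I in II) \int[mu]_x (e ^+ 2 * H I x).
  apply: block_entropy_le.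
  - by apply: eboundedD; [exact: ebounded_cst|exact: eboundedZ].
  - by move=> I II_I; apply: eboundedZ; exact: bH.
  - by move=> I x; rewrite mulr_ge0// sqr_ge0.
  - move=> I II_I; apply: filterS (fH I II_I) => x; apply: filterS => y fxy.
    have := ler_wpM2l (sqr_ge0 e) fxy; rewrite HJ//; nra.
apply: le_trans hE _.
rewrite le_eqVlt; apply/orP; left; apply/eqP.
rewrite ebounded_Rintegral_sum// !mulr_sumr; apply: eq_bigr => I II_I.
rewrite (ebounded_RintegralZ _ (bH I II_I)); ring.
Qed.

(** The part of |h^(l+1) f|^2 whose outermost difference is along [I]; it is the majorant [H] for
    |h^(l) f|. *)
Definition hsum (l : nat) (f : BS -> R) (I : {set 'I_n}) (x : BS) : R :=
  \sum_(t : l.-tuple {set 'I_n} | all (fun I => I \in II) t) hI m I (hseq m t f) x ^+ 2.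

Lemma hnorm_sqr l f x : hnorm m II l f x ^+ 2 =
  \sum_(t : l.-tuple {set 'I_n} | all (fun I => I \in II) t) hseq m t f x ^+ 2.
Proof. by rewrite sqr_sqrtr// sumr_ge0// => t _; exact: sqr_ge0. Qed.

Lemma sum_hsum l f x : \sum_(I in II) hsum l f I x = hnorm m II l.+1 f x ^+ 2.
Proof.
rewrite hnorm_sqr.
by rewrite (sum_tuple_cons (fun I => I \in II) l (fun t => hseq m t f x ^+ 2)).
Qed.

Lemma hsum_ge0 l f I x : 0 <= hsum l f I x.
Proof. by apply: sumr_ge0 => t _; exact: sqr_ge0. Qed.

Lemma hsum_join l f I x y : I \in II -> hsum l f I (join I x y) = hsum l f I x.
Proof. by move=> II_I; apply: eq_bigr => t _; rewrite hI_join. Qed.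

Lemma ebounded_hsum l f I : I \in II -> ebounded mu f -> ebounded mu (hsum l f I).
Proof.
move=> II_I bf; apply: ebounded_sum => t tII; apply: eboundedX.
by apply: ebounded_hI => //; exact: ebounded_hseq.
Qed.

Lemma ebounded_hnorm l f : ebounded mu f -> ebounded mu (hnorm m II l f).
Proof.
move=> bf.
have bs : ebounded mu (fun x => hnorm m II l f x ^+ 2).
  under eq_fun do rewrite hnorm_sqr.
  by apply: ebounded_sum => t tII; apply: eboundedX; exact: ebounded_hseq.
apply: (@ebounded_le _ _ _ _ _ (fun x => 1 + hnorm m II l f x ^+ 2)).
- have -> : hnorm m II l f = Num.sqrt \o (fun x => hnorm m II l f x ^+ 2).
    by apply/funext => x /=; rewrite sqrtr_sqr ger0_norm// sqrtr_ge0.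
  apply: measurableT_comp; first exact: continuous_measurable_fun (@sqrt_continuous R).
  exact: bs.1.
- by apply: eboundedD => //; exact: ebounded_cst.
- apply: aeW => x; have h0 : 0 <= hnorm m II l f x by exact: sqrtr_ge0.
  rewrite !ger0_norm// ?addr_ge0 ?sqr_ge0//; nra.
Qed.

(** Each of the finitely many iterated differences obeys its own almost-everywhere bound; the
    reverse triangle inequality combines them. *)
Lemma ae_hnorm_join l f I : I \in II -> ebounded mu f ->
  \forall x \ae mu, \forall y \ae m I x,
    (hnorm m II l f x - hnorm m II l f (join I x y)) ^+ 2 <= 2 * hsum l f I x.
Proof.
move=> II_I bf.
have := @ae_forall_fin _ _ _ mu _ (fun t : l.-tuple {set 'I_n} => all (fun I => I \in II) t)
  (fun t x => \forall y \ae m I x,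
    (hseq m t f x - hseq m t f (join I x y)) ^+ 2 <= 2 * hI m I (hseq m t f) x ^+ 2).
have h t : all (fun I => I \in II) t -> ebounded mu (hseq m t f) by move=> ?; exact: ebounded_hseq.
move=> /(_ (fun t tII => ae_hI II_I (h t tII))).
apply: filterS => x /ae_forall_fin; apply: filterS => y hy.
apply: le_trans (sqrt_sum_sqr_dist _ _ _) _.
by rewrite /hsum mulr_sumr; apply: ler_sum => t /hy.
Qed.

(** Induction on j = d - l, starting from the uniform bound 1 at level d. Level l + 1 provides the
    constant M = (6 K sigma^2)^j for all orders at once, and one iteration multiplies it by at most
    6 K sigma^2. *)
Lemma hnorm_moments f (s : R) d K : 0 < s -> sigma2 = s ^+ 2 -> ebounded mu f -> (0 < K)%N ->
  (forall k : nat, (1 <= k < d)%N ->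
     (Lnorm mu 2%:E (EFin \o hnorm m II k f) <= (Num.min 1 (s ^+ (d - k)))%:E)%E) ->
  (Lnorm mu +oo%E (EFin \o hnorm m II d f) <= 1%:E)%E ->
  forall j, (j < d)%N -> forall k, (k < K)%N ->
    \int[mu]_x ((hnorm m II (d - j) f x ^+ 2) ^+ k.+1) <= ((6 * K%:R * sigma2) ^+ j) ^+ k.+1.
Proof.
move=> s0 sE bf K0 Hk Hdd.
have sg0 : 0 < sigma2 by rewrite sE exprn_gt0.
have K1 : 1 <= K%:R :> R by rewrite ler1n.
have c0 : 0 < 6 * K%:R * sigma2 by rewrite !mulr_gt0// (lt_le_trans _ K1).
have bh l : ebounded mu (fun x => hnorm m II l f x ^+ 2).
  by apply: eboundedX; exact: ebounded_hnorm.
elim=> [_ k _|j ih jd k kK].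
  rewrite subn0 expr0 expr1n -[leRHS](prob_Rintegral_cst mu).
  apply: le_Rintegral_ae.
  - exact/ebounded_integrable/eboundedX.
  - exact/ebounded_integrable/ebounded_cst.
  - have mu1 : (0 < mu setT)%E by rewrite probability_setT.
    move: Hdd; rewrite unlock mu1 => /ess_supP; apply: filterS => x /=.
    rewrite lee_fin => hx; rewrite exprn_ile1// ?sqr_ge0//.
    by rewrite -real_normK ?num_real// exprn_ile1.
have jd' := ltnW jd.
have lE : (d - j = (d - j.+1).+1)%N by rewrite subnSK.
set l := (d - j.+1)%N; have {}ih := ih jd'.
have ih' : forall i, (i < K)%N -> \int[mu]_x ((\sum_(I in II) hsum l f I x) ^+ i.+1) <=
    ((6 * K%:R * sigma2) ^+ j) ^+ i.+1.
  by move=> i iK; under eq_Rintegral do rewrite sum_hsum -lE; exact: ih.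
have M0 : 0 < (6 * K%:R * sigma2) ^+ j by rewrite exprn_gt0.
have E0 : \int[mu]_x (hnorm m II l f x ^+ 2) <= 4 * sigma2 * (6 * K%:R * sigma2) ^+ j.
  (* Here d - l = j + 1, so the L^2 hypothesis bounds this second moment by sigma^(2(j+1)). *)
  apply: (@le_trans _ _ ((s ^+ j.+1) ^+ 2)).
    apply: Lnorm2_le; [by rewrite exprn_ge0// ltW|exact: ebounded_hnorm|].
    have ld : (1 <= l < d)%N by rewrite subn_gt0 jd /l ltn_subrL/= (leq_trans _ jd).
    have := Hk l ld; rewrite subKn// => /le_trans; apply.
    by rewrite lee_fin ge_min lexx orbT.
  rewrite exprAC -sE exprS.
  have : sigma2 ^+ j <= (6 * K%:R * sigma2) ^+ j.
    rewrite lerXn2r ?nnegrE ?(ltW sg0) ?(ltW c0)// ler_peMl ?(ltW sg0)//; lra.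
  move=> /(ler_wpM2l (ltW sg0)); have : 0 <= sigma2 * (6 * K%:R * sigma2) ^+ j.
    by rewrite mulr_ge0// ltW.
  lra.
have := block_moment_iteration sg0 (ebounded_hnorm l bf) (fun I II_I => ebounded_hsum l II_I bf)
  (hsum_ge0 l f) (fun I x y => @hsum_join l f I x y) (fun I II_I => ae_hnorm_join l II_I bf)
  M0 ih' E0 kK.
move=> /le_trans; apply; rewrite lerXn2r ?nnegrE ?exprn_ge0 ?(ltW c0)//.
  by rewrite !mulr_ge0// ltW.
rewrite exprS -!mulrA ler_wpM2l// ler_wpM2r ?ler_nat//.
by rewrite mulr_ge0// ltW// mulrA.
Qed.

(** The last descent, from level 1 to 0, is separate: [hnorm] of order 0 is |f| rather than the
    centred f, and the starting second moment comes from Poincare and the first moment of |h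
    f|^2. *)
Lemma centered_moments f (s : R) d K : 0 < s -> sigma2 = s ^+ 2 -> ebounded mu f -> (0 < d)%N ->
  (0 < K)%N ->
  (forall k : nat, (1 <= k < d)%N ->
     (Lnorm mu 2%:E (EFin \o hnorm m II k f) <= (Num.min 1 (s ^+ (d - k)))%:E)%E) ->
  (Lnorm mu +oo%E (EFin \o hnorm m II d f) <= 1%:E)%E ->
  \int[mu]_x (((f x - Exp mu f) ^+ 2) ^+ K) <= (6 * K%:R * sigma2) ^+ (d * K).
Proof.
move=> s0 sE bf; case: d => // d _; case: K => // K _ Hk Hdd.
have sg0 : 0 < sigma2 by rewrite sE exprn_gt0.
have c0 : 0 < 6 * K.+1%:R * sigma2 by rewrite !mulr_gt0.
have := hnorm_moments s0 sE bf (ltn0Sn K) Hk Hdd (ltnSn d).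
rewrite subSnn => ih.
have bg : ebounded mu (fun x => f x - Exp mu f).
  by apply: eboundedB => //; exact: ebounded_cst.
have ih' : forall i, (i < K.+1)%N -> \int[mu]_x ((\sum_(I in II) hsum 0 f I x) ^+ i.+1) <=
    ((6 * K.+1%:R * sigma2) ^+ d) ^+ i.+1.
  by move=> i iK; under eq_Rintegral do rewrite sum_hsum; exact: ih.
have gH I : I \in II -> \forall x \ae mu, \forall y \ae m I x,
    ((f x - Exp mu f) - (f (join I x y) - Exp mu f)) ^+ 2 <= 2 * hsum 0 f I x.
  move=> II_I; apply: filterS (ae_hI II_I bf) => x; apply: filterS => y.
  rewrite opprB addrA subrK /hsum (big_pred1 [tuple])//.
  by move=> t; rewrite [t]tuple0 /= eqxx.
have Eg : \int[mu]_x (f x - Exp mu f) = 0.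
  rewrite ebounded_RintegralD// ?prob_Rintegral_cst ?subrr//.
  exact: ebounded_cst.
have bH I := @ebounded_hsum 0 f I ^~ bf.
have HJ I x y := @hsum_join 0 f I x y.
have M0 : 0 < (6 * K.+1%:R * sigma2) ^+ d by rewrite exprn_gt0.
have E0 : \int[mu]_x ((f x - Exp mu f) ^+ 2) <= 4 * sigma2 * (6 * K.+1%:R * sigma2) ^+ d.
  apply: le_trans (block_poincare bg bH (hsum_ge0 0 f) HJ gH Eg) _.
  have := ih' 0 isT; under eq_Rintegral do rewrite expr1; rewrite expr1 => h.
  have := ler_wpM2l (ltW sg0) h; have : 0 <= sigma2 * (6 * K.+1%:R * sigma2) ^+ d.
    by rewrite mulr_ge0// ltW.
  lra.
have := block_moment_iteration sg0 bg bH (hsum_ge0 0 f) HJ gH M0 ih' E0 (ltnSn K).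
by rewrite -exprS -exprM.
Qed.

End blocks.

Unset Implicit Arguments.

Theorem theorem1p5 (R : realType) (n : nat)
  (S : 'I_n -> completePseudoMetricType R)
  (HS : forall i, polish (S i))
  (mu : probability (BorelS S) R)
  (II : {set {set 'I_n}})
  (m : {set 'I_n} -> BorelS S -> probability (BorelS S) R)
  (Hm : forall I, I \in II -> disintegration mu I (m I))
  (d : nat) (Hd : (0 < d)%N)
  (sigma : R) (Hsigma : 0 < sigma)
  (HLSI : LSI m mu II (sigma ^+ 2))
  (f : BorelS S -> R) (Hf : Linfty mu f)
  (Hk : forall k : nat, (1 <= k < d)%N ->
     (Lnorm mu 2%:E (EFin \o hnorm m II k f) <= (Num.min 1 (sigma ^+ (d - k)))%:E)%E)
  (Hdd : (Lnorm mu +oo%E (EFin \o hnorm m II d f) <= 1%:E)%E) :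
  let c := (12 * sigma ^+ 2 * expR 1)^-1 in
  (\int[mu]_x (expR (c * `|f x - Exp mu f| `^ (2%:R / d%:R)))%:E <= 2%:E)%E.
Proof.
cbv zeta; set c := (12 * _ * _)^-1.
have bf : ebounded mu f by split; [exact: Hf.1|apply/Linfty_ebounded; [exact: Hf.1|exact: Hf.2]].
have s2 : 0 < sigma ^+ 2 by rewrite exprn_gt0.
(* Since V^d = (f - E f)^2, the moment of order 2K of f - E f is that of order d K of V, and its
   d-th root grows like (6 K sigma^2)^K. *)
pose V x := `|f x - Exp mu f| `^ (2%:R / d%:R).
have bg : ebounded mu (fun x => f x - Exp mu f).
  by apply: eboundedB => //; exact: ebounded_cst.
have mV : measurable_fun setT V.
  apply: (measurableT_comp (f := (@powR R)^~ (2%:R / d%:R))); first exact: measurable_powR.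
  by apply: measurableT_comp => //; exact: bg.1.
have V0 x : 0 <= V x by exact: powR_ge0.
have Vd x : V x ^+ d = (f x - Exp mu f) ^+ 2.
  rewrite -powR_mulrn// -powRrM divfK ?pnatr_eq0 -?lt0n// powR_mulrn//.
  by rewrite real_normK// num_real.
have bV : ebounded mu V.
  apply: (@ebounded_le _ _ _ _ _ (fun x => 1 + V x ^+ d)) => //.
    apply: eboundedD; first exact: ebounded_cst.
    by under eq_fun do rewrite Vd; exact: eboundedX.
  apply: aeW => x; rewrite !ger0_norm// ?addr_ge0 ?exprn_ge0//.
  have [V1|V1] := leP 1 (V x).
    by rewrite (le_trans (ler_eXnr Hd V1))// lerDr.
  by rewrite (le_trans (ltW V1))// lerDl exprn_ge0.
(* With w = 6 sigma^2 the condition c w e = 1/2 is exactly the stated c. *)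
apply: (@expR_moment_le2 _ _ _ mu V (6 * sigma ^+ 2) c) => //.
- by rewrite mulr_ge0// ltW.
- by rewrite invr_ge0 !mulr_ge0 ?expR_ge0// ltW.
- rewrite /c le_eqVlt; apply/orP; left; apply/eqP; field.
  by rewrite !gt_eqF ?expR_gt0.
- move=> k; rewrite -ebounded_fineK ?lee_fin; last exact: eboundedX.
  have W0 : 0 < k.+1%:R * (6 * sigma ^+ 2) by rewrite !mulr_gt0.
  (* Jensen with the power d, passed as [d.-1] because the lemma counts from n+1. *)
  apply: (@moment_root _ _ _ mu V _ k.+1 d.-1 mV V0 (eboundedX _ bV) W0).
  rewrite prednK//.
  have := centered_moments HS Hm (ltW s2) HLSI Hsigma erefl bf Hd (ltn0Sn k) Hk Hdd.
  under eq_Rintegral do rewrite -Vd -exprM; rewrite mulnC.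
  by rewrite [6 * _]mulrC -mulrA.
Qed.
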